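(* Let $q = 2^h$ with $h > 1$ and let $n$ be a prime. Let $\delta_0$ be a nonnegative integer with $\delta_0 \le q-2$ such that the following holds: every incidence structure $\mathcal{D} = (P, B, \in)$ with $|P| = q^n+1$, whose blocks (elements of $B$) are subsets of $P$ of size $q+1$ such that any three distinct points lie in at most one block, and for which there is a subset $Q \subseteq P$ with $|Q| = \delta \le \delta_0$ such that every triple of distinct points of $P$ having at most one element in $Q$ lies in exactly one block, is a $3$-$(q^n+1, q+1, 1)$ design. Let $\mathcal{O} = \{\pi_0, \dots, \pi_{q^n+1}\}$ be a pseudo-hyperoval of $\mathbf{PG}(3n-1,q)$ and, for each $i$, let $\Delta_i = \{\langle \pi_i, \pi_j\rangle \cap \mathbf{PG}(2n-1,q) : j \neq i\}$ with $\mathbf{PG}(2n-1,q)$ a $(2n-1)$-dimensional subspace skew to $\pi_i$. Then $\mathcal{O}$ is regular if and only if at least $q^n + 1 - \delta_0$ of the $(n-1)$-spreads $\Delta_0, \dots, \Delta_{q^n+1}$ are regular.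
   Context: A generalized $k$-arc of $\mathbf{PG}(3n-1,q)$ is a set of $k$ subspaces of dimension $n-1$ any three of which span $\mathbf{PG}(3n-1,q)$; for $q$ even, a pseudo-hyperoval is a generalized $(q^n+2)$-arc. Each $\Delta_i$ is an $(n-1)$-spread of $\mathbf{PG}(2n-1,q)$, whose regularity does not depend on the chosen complement. An $(n-1)$-regulus of $\mathbf{PG}(2n-1,q)$ is a set of $q+1$ pairwise disjoint $(n-1)$-dimensional subspaces such that every line meeting three of them meets all of them, and every point of such a transversal lies in one of them; any three pairwise disjoint $(n-1)$-spaces lie in a unique $(n-1)$-regulus. An $(n-1)$-spread is regular if for any three of its elements the $(n-1)$-regulus they determine is contained in the spread. A $3$-$(v,k,1)$ design is a set of $v$ points with a family of $k$-subsets (blocks) such that every $3$ distinct points lie in exactly one block. Regular pseudo-hyperoval: in $\mathbf{PG}(3n-1,q^n)$ take planes $\xi_1,\dots,\xi_n$ forming an orbit of $\mathrm{Gal}(\mathbb{F}_{q^n}/\mathbb{F}_q)$ and spanning $\mathbf{PG}(3n-1,q^n)$; take a hyperoval $\{x_0^{(1)},\dots,x_{q^n+1}^{(1)}\}$ of $\xi_1$ ($q^n+2$ points, no three collinear), let $x_i^{(1)},\dots,x_i^{(n)}$ be the Galois conjugates of $x_i^{(1)}$ and $\pi_i$ the $(n-1)$-space over $\mathbb{F}_q$ they span; pseudo-hyperovals arising this way (up to projective equivalence) are called regular. *)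

(* Defs.v *)
From HB Require Import structures.
From mathcomp Require Import all_boot all_algebra fingroup falgebra fieldext galois.

Set Implicit Arguments.
Unset Strict Implicit.
Unset Printing Implicit Defensive.

Import GRing.Theory.

(* Projective subspaces are vector subspaces: projective dimension d means
   vector-space dimension d + 1, and skew means meeting in the zero space.
   The points of PG(V) are the lines <[v]> with v != 0. *)

Section Designs.

Variables (P : finType) (B : {set {set P}}).

Definition blocks_through (T : {set P}) : {set {set P}} :=
  [set b in B | T \subset b].

Definition is_3design (v k : nat) : Prop :=
  [/\ #|P| = v,
      forall b, b \in B -> #|b| = k
    & forall T : {set P}, #|T| = 3 -> #|blocks_through T| = 1].

Definition is_near_3design (v k d : nat) : Prop :=
  [/\ #|P| = v,
      forall b, b \in B -> #|b| = k,
      forall T : {set P}, #|T| = 3 -> #|blocks_through T| <= 1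
    & exists Q : {set P}, #|Q| <= d /\
        forall T : {set P}, #|T| = 3 -> #|T :&: Q| <= 1 ->
          #|blocks_through T| = 1].

End Designs.

Section Spreads.

Variables (F : finFieldType) (V : vectType F).
Implicit Types (W U l : {vspace V}) (S R : seq {vspace V}).

Definition is_spread (n : nat) W S : Prop :=
  (forall U, U \in S -> (U <= W)%VS /\ \dim U = n) /\
  (forall v : V, v \in W -> v != 0%R -> exists! U, (U \in S) && (v \in U)).

Definition meets U W : bool := (U :&: W != 0)%VS.

(* l is a line of PG(W) meeting three distinct members of R. *)
Definition is_transversal_line W R l : Prop :=
  [/\ (l <= W)%VS, \dim l = 2
    & exists U1 U2 U3 : {vspace V},
      [/\ uniq [:: U1; U2; U3], {subset [:: U1; U2; U3] <= R}
        & all (meets l) [:: U1; U2; U3]]].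

Definition is_regulus (n : nat) W R : Prop :=
  [/\ uniq R /\ size R = #|F| + 1,
      forall U, U \in R -> (U <= W)%VS /\ \dim U = n,
      forall U1 U2, U1 \in R -> U2 \in R -> U1 != U2 -> (U1 :&: U2 = 0)%VS
    & forall l, is_transversal_line W R l ->
        (forall U, U \in R -> meets l U) /\
        (forall v : V, v \in l -> v != 0%R -> exists2 U, U \in R & v \in U)].

(* Three pairwise skew (n-1)-spaces of PG(2n-1,q) lie in exactly one
   (n-1)-regulus, so R below is the regulus determined by U1, U2, U3. *)
Definition is_regular_spread (n : nat) W S : Prop :=
  is_spread n W S /\
  forall U1 U2 U3 : {vspace V},
    uniq [:: U1; U2; U3] -> {subset [:: U1; U2; U3] <= S} ->
    forall R, is_regulus n W R -> {subset [:: U1; U2; U3] <= R} ->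
      {subset R <= S}.

End Spreads.

Section PseudoHyperovals.

Variables (F : finFieldType) (n : nat).
Local Notation V := 'rV[F]_(3 * n).

Definition is_generalized_arc (k : nat) (pi : 'I_k -> {vspace V}) : Prop :=
  [/\ injective pi,
      forall i, \dim (pi i) = n
    & forall i j l, uniq [:: i; j; l] -> (pi i + pi j + pi l = fullv)%VS].

Definition is_pseudo_hyperoval (pi : 'I_(#|F| ^ n + 2) -> {vspace V}) : Prop :=
  is_generalized_arc pi.

(* The elements of Delta_i, where W is the chosen complement of pi i. *)
Definition Delta (k : nat) (pi : 'I_k -> {vspace V}) (i : 'I_k)
    (W : {vspace V}) : seq {vspace V} :=
  [seq ((pi i + pi j) :&: W)%VS | j <- enum 'I_k & j != i].

(* x represents a hyperoval of the plane xi (a row space) by vectors. *)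
Definition is_hyperoval (K : fieldType) (N k : nat) (xi : 'M[K]_(3, N))
    (x : 'I_k -> 'rV[K]_N) : Prop :=
  (forall i, x i != 0%R /\ (x i <= xi)%MS) /\
  (forall i j l, uniq [:: i; j; l] -> \rank (x i + x j + x l)%MS = 3).

(* The L-span of all Gal(L/F)-conjugates of the row space of A. *)
Definition conj_span (L : splittingFieldType F) (m N : nat)
    (A : 'M[L]_(m, N)) : 'M[L]_N :=
  (\sum_(s in 'Gal({:L} / 1%VS)%g) <<map_mx (fun a : L => s a) A>>)%MS.

(* L is the field with q^n elements.  The n conjugates of the plane xi span the
   whole space exactly when they are independent, so they are then pairwise
   distinct.  rho i consists of the F-rational vectors of the L-space spanned by
   the conjugates of the point x i. *)
Definition is_standard_regular (rho : 'I_(#|F| ^ n + 2) -> {vspace V}) : Prop :=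
  exists L : splittingFieldType F, \dim {:L} = n /\
  exists (xi : 'M[L]_(3, 3 * n)) (x : 'I_(#|F| ^ n + 2) -> 'rV[L]_(3 * n)),
    [/\ \rank xi = 3,
        row_full (conj_span xi),
        is_hyperoval xi x
      & forall i (v : V),
          (v \in rho i) = (map_mx (in_alg L) v <= conj_span (x i))%MS].

Definition is_regular_pseudo_hyperoval
    (pi : 'I_(#|F| ^ n + 2) -> {vspace V}) : Prop :=
  exists (rho : 'I_(#|F| ^ n + 2) -> {vspace V}) (g : 'End(V)),
    [/\ is_standard_regular rho, (lker g = 0)%VS
      & forall i, pi i = (g @: rho i)%VS].

End PseudoHyperovals.

(* Main.v *)
Require Import Defs.
From mathcomp Require Import all_boot all_algebra.
From mathcomp Require Import fingroup falgebra fieldext galois finfield.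
From mathcomp Require Import ring zify.

(** Modulo an element [pi i], the other elements of a pseudo-hyperoval become a
spread of a 2n-dimensional space, that is, a set of slopes: n x n matrices and
infinity.  If this spread is regular, its slopes form an additive group that is
closed under inversion after normalisation, so by Hua's identity it contains all
powers of each of its elements; as n is prime, it is a coset [s F[t]] of the
field generated by any non-scalar [t = s^-1 s'].  Hence two such sets that share
two non-proportional slopes coincide.

Take [e1], [e2] in the set [A] of indices with a regular spread as the points at
infinity of coordinates [(a m, b m)].  If two further members [i], [j] of [A] have the
same set of slopes, all coordinates lie in one field of order q^n and the
pseudo-hyperoval is regular.  Otherwise the slope sets of [i] and [j] meet only
in the multiples of the slope of [ij], which says that [a m |-> b m] maps the
affine line through [i] and [j] to an affine line.  At most q - 1 indices are
outside [A], so all lines are mapped to lines, and the map is additive because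
q > 2; but then all slope sets are equal.

For the field reduction itself, an eigenvector [eta] of [t] over F(t) and its
Galois conjugates form a basis, so the conjugates of [eta M] span the row space
of [M] for every matrix [M] over F.  Conversely, every member of the regulus
of three elements of [Delta i] meets the plane [xi] in a line through [x i]. *)

Set Implicit Arguments.
Unset Strict Implicit.
Unset Printing Implicit Defensive.

Import GRing.Theory.
Local Open Scope ring_scope.

(** * Row spaces and reguli *)

Section RowVspace.

Variables (F : fieldType) (N : nat).
Implicit Types (U : {vspace 'rV[F]_N}).

(** Spaces are handled through generator matrices with a fixed number of rows, so that combinations
    such as [P + a *: Q] and left multiplication by square matrices make sense for them. *)
Definition rowvs m (M : 'M[F]_(m, N)) : {vspace 'rV[F]_N} :=
  limg (linfun (mulmxr M : 'rV_m -> 'rV_N)).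

Lemma mem_rowvsP m (M : 'M[F]_(m, N)) v :
  reflect (exists x : 'rV_m, v = x *m M) (v \in rowvs M).
Proof.
apply: (iffP memv_imgP) => [[x _ ->]|[x ->]]; exists x; rewrite ?memvf //.
  by rewrite lfunE.
by rewrite lfunE.
Qed.

Lemma mem_rowvs m (M : 'M[F]_(m, N)) v : (v \in rowvs M) = (v <= M)%MS.
Proof. by apply/mem_rowvsP/submxP. Qed.

Lemma rowvs_mul m (M : 'M[F]_(m, N)) (x : 'rV_m) : x *m M \in rowvs M.
Proof. by apply/mem_rowvsP; exists x. Qed.

Lemma rowvs_sub m1 m2 (A : 'M[F]_(m1, N)) (B : 'M[F]_(m2, N)) :
  (rowvs A <= rowvs B)%VS = (A <= B)%MS.
Proof.
apply/subvP/idP => [AB|AB v]; last by rewrite !mem_rowvs => /submx_trans; apply.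
by apply/row_subP => i; rewrite -mem_rowvs AB // mem_rowvs row_sub.
Qed.

Lemma eqmx_rowvs m1 m2 (A : 'M[F]_(m1, N)) (B : 'M[F]_(m2, N)) :
  (A :=: B)%MS -> rowvs A = rowvs B.
Proof. by move=> AB; apply/vspaceP=> v; rewrite !mem_rowvs AB. Qed.

Lemma dim_rowvs m (M : 'M[F]_(m, N)) : \dim (rowvs M) = \rank M.
Proof.
rewrite -(eqmx_rowvs (eq_row_base M)) limg_dim_eq ?dimvf /dim /= ?mul1n //.
apply/eqP; rewrite -subv0; apply/subvP => x.
rewrite memv_cap => /andP[_]; rewrite memv_ker lfunE /= => /eqP xM0.
rewrite memv0; apply/eqP; apply: (row_free_inj (row_base_free M)).
by rewrite mul0mx.
Qed.

Lemma rowvs_exists U : {M : 'M[F]_(\dim U, N) | U = rowvs M}.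
Proof.
exists (\matrix_i (vbasis U)`_i).
apply/vspaceP => v; apply/idP/mem_rowvsP => [vU|[x ->]].
  exists (\row_i coord (vbasis U) i v).
  rewrite mulmx_sum_row {1}(coord_vbasis vU); apply: eq_bigr => i _.
  by rewrite mxE rowK.
rewrite mulmx_sum_row; apply: rpred_sum => i _.
by rewrite rowK rpredZ // vbasis_mem // mem_nth // size_tuple.
Qed.

Lemma rowvs_dim n U : \dim U = n -> {M : 'M[F]_(n, N) | U = rowvs M}.
Proof. by move=> <-; exact: rowvs_exists. Qed.

Lemma rowvs_unit n (A : 'M[F]_n) (M : 'M[F]_(n, N)) :
  A \in unitmx -> rowvs (A *m M) = rowvs M.
Proof. by move=> uA; apply: eqmx_rowvs; apply: eqmxMfull; rewrite row_full_unit. Qed.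

End RowVspace.

Section Pencil.

Variables (F : finFieldType) (N n : nat).
Implicit Types (P Q : 'M[F]_(n, N)) (W U : {vspace 'rV[F]_N}).

(** Amounts to [row_free (col_mx P Q)], in a form that lets the coefficients of [P] and of [Q] be
    compared separately. *)
Definition indep2 P Q := forall x y : 'rV[F]_n, x *m P + y *m Q = 0 -> x = 0 /\ y = 0.

Lemma indep2_cap P Q : (rowvs P :&: rowvs Q = 0)%VS -> row_free P -> row_free Q -> indep2 P Q.
Proof.
move=> cap0 fP fQ x y /eqP; rewrite addr_eq0 => /eqP xy.
have xP0 : x *m P = 0.
  apply/eqP; rewrite -memv0 -cap0 memv_cap rowvs_mul xy -mulNmx.
  exact: rowvs_mul.
split; first by apply: (row_free_inj fP); rewrite mul0mx.
by apply: (row_free_inj fQ); apply/oppr_inj; rewrite -xy xP0 mul0mx oppr0.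
Qed.

(** For independent [P] and [Q] this is the regulus through [rowvs P], [rowvs Q] and
    [rowvs (P + Q)]; the head of the list is the member with parameter infinity. *)
Definition pencil P Q : seq {vspace 'rV[F]_N} :=
  rowvs Q :: [seq rowvs (P + a *: Q) | a <- enum F].

Lemma rowvsZ (a : F) P : a != 0 -> rowvs (a *: P) = rowvs P.
Proof. by move=> a0; apply: eqmx_rowvs; apply: eqmx_scale. Qed.

Lemma pencil_hom P Q U : U \in pencil P Q ->
  exists a b : F, ((a != 0) || (b != 0)) /\ U = rowvs (a *: P + b *: Q).
Proof.
rewrite inE => /predU1P[->|/mapP[b _ ->]].
  by exists 0, 1; rewrite oner_eq0 orbT scale0r add0r scale1r.
by exists 1, b; rewrite oner_eq0 scale1r.
Qed.

Lemma mem_pencil P Q (a b : F) : (a != 0) || (b != 0) -> rowvs (a *: P + b *: Q) \in pencil P Q.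
Proof.
have [->/= b0|a0 _] := eqVneq a 0.
  by rewrite scale0r add0r rowvsZ // mem_head.
rewrite inE; apply/orP; right; apply/mapP; exists (b / a); rewrite ?mem_enum //.
by rewrite -[RHS](rowvsZ _ a0) scalerDr scalerA mulrCA mulfV // mulr1.
Qed.

Section Independent.

Variables P Q : 'M[F]_(n, N).
Hypothesis PQ : indep2 P Q.

Lemma indep2_eq (x y x' y' : 'rV_n) :
  x *m P + y *m Q = x' *m P + y' *m Q -> x = x' /\ y = y'.
Proof.
move/eqP; rewrite -subr_eq0 opprD addrACA -!mulmxBl => /eqP/PQ[].
by move=> /eqP; rewrite subr_eq0 => /eqP -> /eqP; rewrite subr_eq0 => /eqP.
Qed.

Lemma pencil_free (a b : F) : (a != 0) || (b != 0) -> row_free (a *: P + b *: Q).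
Proof.
move=> ab; apply: inj_row_free => x; rewrite mulmxDr -!scalemxAr !scalemxAl.
move=> /PQ[/eqP]; rewrite scalemx_eq0 => xa /eqP; rewrite scalemx_eq0 => xb.
by case/orP: ab => /negPf z; rewrite z /= in xa xb; apply/eqP.
Qed.

Lemma dim_pencil U : U \in pencil P Q -> \dim U = n.
Proof.
case/pencil_hom=> a [b [ab ->]]; rewrite dim_rowvs; apply/eqP.
exact: pencil_free.
Qed.

Lemma pencil_cap (a b c d : F) : a * d - b * c != 0 ->
  (rowvs (a *: P + b *: Q) :&: rowvs (c *: P + d *: Q) = 0)%VS.
Proof.
move=> D; apply/eqP; rewrite -subv0; apply/subvP => v; rewrite memv_cap memv0.
case/andP=> /mem_rowvsP[x ->] /mem_rowvsP[y].
rewrite !mulmxDr -!scalemxAr !scalemxAl => /indep2_eq[E1 E2].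
suff -> : x = 0 by rewrite !scaler0 !mul0mx addr0.
apply/eqP; rewrite -[_ == _]orFb -(negPf D) -scaler_eq0 scalerBl.
rewrite mulrC -scalerA E1 mulrC -scalerA E2 !scalerA.
by rewrite [d * c]mulrC subrr.
Qed.

(** A vanishing determinant makes [(a, b)] and [(c, d)] proportional, and proportional parameters
    give the same row space. *)
Lemma pencil_det (a b c d : F) : (a != 0) || (b != 0) -> (c != 0) || (d != 0) ->
  rowvs (a *: P + b *: Q) != rowvs (c *: P + d *: Q) -> a * d - b * c != 0.
Proof.
move=> ab cd; apply: contra_neq => /eqP; rewrite subr_eq0 => /eqP E.
have [a0|a0] := eqVneq a 0.
  rewrite a0 eqxx /= in ab; move: E => /esym/eqP.
  rewrite a0 mul0r mulf_eq0 (negPf ab) /= => /eqP c0.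
  rewrite c0 eqxx /= in cd.
  by rewrite c0 !scale0r !add0r !rowvsZ.
have c0 : c != 0.
  apply: contraTneq cd => c0; move/eqP: E; rewrite c0 mulr0 mulf_eq0 (negPf a0) /=.
  by move=> /eqP ->; rewrite eqxx.
rewrite -(rowvsZ _ c0) -[RHS](rowvsZ _ a0) !scalerDr !scalerA E mulrC.
by rewrite [c * b]mulrC.
Qed.

(* Three members of the pencil met by a line [l] force [l] to be
   [<x P, x Q>] for one vector [x]: eliminating the third intersection
   point makes the first two coordinate vectors proportional. *)
Lemma transversal_pencil W l : is_transversal_line W (pencil P Q) l ->
  exists2 x : 'rV_n, x != 0 & forall v, v \in l -> exists a b : F, v = x *m (a *: P + b *: Q).
Proof.
case=> lW dl [U1 [U2 [U3 [U123 UR]]]] /=; rewrite andbT.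
move: U123; rewrite /= !inE negb_or !andbT => /andP[/andP[n12 n13] n23].
have UR1 : U1 \in pencil P Q by apply: UR; rewrite inE eqxx.
have UR2 : U2 \in pencil P Q by apply: UR; rewrite !inE eqxx orbT.
have UR3 : U3 \in pencil P Q by apply: UR; rewrite !inE eqxx !orbT.
have [a1 [b1 [z1 E1]]] := pencil_hom UR1.
have [a2 [b2 [z2 E2]]] := pencil_hom UR2.
have [a3 [b3 [z3 E3]]] := pencil_hom UR3.
have D12 : a1 * b2 - b1 * a2 != 0 by apply: pencil_det => //; rewrite -E1 -E2.
have D13 : a1 * b3 - b1 * a3 != 0 by apply: pencil_det => //; rewrite -E1 -E3.
have D23 : a2 * b3 - b2 * a3 != 0 by apply: pencil_det => //; rewrite -E2 -E3.
case/and3P; rewrite /meets -!vpick0 => p1 p2 p3.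
have := memv_pick (l :&: U1)%VS; have := memv_pick (l :&: U2)%VS.
have := memv_pick (l :&: U3)%VS.
rewrite !memv_cap.
set u1 := vpick _ in p1 *; set u2 := vpick _ in p2 *; set u3 := vpick _ in p3 *.
rewrite E3 E2 E1 => /andP[l3 /mem_rowvsP[x3 D3]].
move=> /andP[l2 /mem_rowvsP[x2 D2]] /andP[l1 /mem_rowvsP[x1 D1]].
(* Members with different parameters are skew, so a nonzero vector of one is never a multiple of a
   vector of another. *)
have skew (u v : 'rV_N) c : u != 0 -> forall a b c' d x y, u = x *m (a *: P + b *: Q) ->
    v = y *m (c' *: P + d *: Q) -> a * d - b * c' != 0 -> u <> c *: v.
  move=> u0 a b c' d x y Eu Ev D E; case/negP: u0; rewrite -memv0 -(pencil_cap D).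
  by rewrite memv_cap {1}Eu rowvs_mul E memvZ // Ev rowvs_mul.
have l12 : (l = <[u1]> + <[u2]>)%VS.
  apply/eqP; rewrite eq_sym eqEdim subv_add -!memvE l1 l2 /= dl.
  rewrite dimv_disjoint_sum ?dim_vline ?p1 ?p2 //.
  apply/eqP; rewrite -subv0; apply/subvP => w; rewrite memv_cap.
  case/andP=> /vlineP[k ->] /vlineP[k' kk].
  have [-> | k0] := eqVneq k 0; first by rewrite scale0r mem0v.
  case: (skew u1 u2 (k^-1 * k') p1 _ _ _ _ _ _ D1 D2 D12).
  by rewrite -scalerA -kk scalerA mulVf // scale1r.
have spanl v : v \in l -> exists k1 k2, v = k1 *: u1 + k2 *: u2.
  rewrite l12 => /memv_addP[_ /vlineP[k1 ->] [_ /vlineP[k2 ->] ->]].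
  by exists k1, k2.
have [k1 [k2 K]] := spanl _ l3.
have k20 : k2 != 0.
  apply/eqP => k20; move: K; rewrite k20 scale0r addr0.
  apply: (skew _ _ _ p3 _ _ _ _ _ _ D3 D1).
  by rewrite -oppr_eq0 opprB mulrC [a1 * b3]mulrC in D13 *.
have x12 : exists k, x2 = k *: x1.
  have : k1 *: u1 + k2 *: u2 == u3 by rewrite -K.
  rewrite D1 D2 D3 !mulmxDr -!scalemxAr !scalemxAl !scalerDr !scalemxAl addrACA.
  rewrite -!mulmxDl => /eqP/indep2_eq[A B].
  (* Multiplying the [P]-equation by [b3] and the [Q]-equation by [a3] gives both the same
     right-hand side, which removes [x3]. *)
  have := congr1 ( *:%R b3) A; have := congr1 ( *:%R a3) B.
  rewrite (scalerA a3 b3) (mulrC a3 b3) -(scalerA b3 a3) => <-.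
  move/eqP; rewrite !scalerDr !scalerA -subr_eq0 opprD addrACA -!scalerBl addr_eq0.
  move=> /eqP X; exists (- (k2 * (a2 * b3 - b2 * a3))^-1 * (k1 * (a1 * b3 - b1 * a3))).
  have z : k2 * (a2 * b3 - b2 * a3) != 0 by rewrite mulf_neq0.
  apply: (scalerI z); rewrite !scalerA mulrA mulrN mulfV // mulN1r scaleNr.
  rewrite -[_ * (a1 * _ - _)]mulr1.
  have -> : k1 * (a1 * b3 - b1 * a3) * 1 = b3 * k1 * a1 - a3 * k1 * b1 by ring.
  rewrite X opprK; congr (_ *: _); ring.
have {x12} [k x2E] := x12.
exists x1; first by apply: contraNneq p1 => x0; rewrite D1 x0 mul0mx.
move=> v /spanl[c1 [c2 ->]].
exists (c1 * a1 + c2 * k * a2), (c1 * b1 + c2 * k * b2).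
rewrite D1 D2 x2E !mulmxDr -!scalemxAr !scalemxAl !scalerDr !scalemxAl !scalerA.
rewrite addrACA -!mulmxDl -!scalerDl.
by rewrite ![c2 * k * _]mulrAC.
Qed.

(** A transversal is [<x P, x Q>] for one vector [x], and its point [x (a P + b Q)] lies in the
    member with the same parameters [(a : b)]. *)
Lemma pencil_regulus W : (0 < n)%N -> (rowvs P <= W)%VS -> (rowvs Q <= W)%VS ->
  is_regulus n W (pencil P Q).
Proof.
move=> n0 PW QW.
have cap0 U1 U2 : U1 \in pencil P Q -> U2 \in pencil P Q -> U1 != U2 -> (U1 :&: U2 = 0)%VS.
  case/pencil_hom=> a [b [ab ->]] /pencil_hom[c [d [cd ->]]] /(pencil_det ab cd).
  exact: pencil_cap.
split=> [||//|l tl].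
(* Two equal members with different parameters would be skew to themselves, hence zero, against
   [0 < n]. *)
- have inj : injective (fun a => rowvs (P + a *: Q)).
    move=> a b E; apply/eqP; apply: contraT => ab.
    have := @pencil_cap 1 a 1 b; rewrite !mul1r mulr1 subr_eq0 eq_sym => /(_ ab).
    rewrite !scale1r E capvv => Z.
    have := @dim_pencil (rowvs (P + b *: Q)).
    rewrite Z dimv0 => H; move: n0; rewrite -H //.
    by have := @mem_pencil P Q 1 b; rewrite scale1r oner_eq0 Z; apply.
  rewrite /= map_inj_uniq // enum_uniq andbT size_map -cardE addn1; split=> //.
  apply/mapP => -[a _ E].
  have := @pencil_cap 0 1 1 a; rewrite mul0r mul1r sub0r oppr_eq0 oner_eq0 => /(_ isT).
  rewrite !scale1r scale0r add0r -E capvv => Z.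
  have := @dim_pencil (rowvs Q); rewrite Z dimv0 => H; move: n0; rewrite -H //.
  by rewrite -Z mem_head.
- move=> U UR; split; last exact: dim_pencil.
  case/pencil_hom: UR => a [b [_ ->]]; apply/subvP=> _ /mem_rowvsP[x ->].
  rewrite mulmxDr -!scalemxAr rpredD // rpredZ //.
    by apply: (subvP PW); apply: rowvs_mul.
  by apply: (subvP QW); apply: rowvs_mul.
- have [x x0 xl] := transversal_pencil tl; have [_ dl _] := tl.
  have lE : l = (<[x *m P]> + <[x *m Q]>)%VS.
    apply/eqP; rewrite eqEdim; apply/andP; split.
      apply/subvP => v /xl[a [b ->]]; rewrite mulmxDr -!scalemxAr.
      by rewrite memv_add // memvZ ?memv_line.
    rewrite dl; apply: leq_trans (dimv_add_leqif _ _) _.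
    by rewrite !dim_vline; case: (_ != 0); case: (_ != 0).
  split=> [U /pencil_hom[a [b [ab ->]]]|v vl v0].
    have fr := pencil_free ab.
    have xm : x *m (a *: P + b *: Q) != 0.
      by apply: contra_neq x0 => E; apply: (row_free_inj fr); rewrite mul0mx.
    rewrite /meets -subv0; apply/negP => /subvP/(_ (x *m (a *: P + b *: Q))).
    rewrite memv0 (negPf xm) memv_cap rowvs_mul andbT => X; suff : false by [].
    apply: X.
    by rewrite lE mulmxDr -!scalemxAr memv_add // memvZ ?memv_line.
  have [a [b E]] := xl _ vl.
  have ab : (a != 0) || (b != 0).
    rewrite -negb_and; apply: contraNN v0 => /andP[/eqP a0 /eqP b0].
    by rewrite E a0 b0 !scale0r addr0 mulmx0.
  by exists (rowvs (a *: P + b *: Q)); [exact: mem_pencil | rewrite E rowvs_mul].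
Qed.

(* Every member of a regulus is a graph [x P + h(x) Q] in which [h x] is
   proportional to [x] for every [x], since it meets all lines [<x P, x Q>]. *)
Lemma regulus_pencil W R : is_regulus n W R ->
  (rowvs P + rowvs Q = W)%VS -> (0 < n)%N ->
  rowvs P \in R -> rowvs Q \in R -> rowvs (P + Q) \in R -> {subset R <= pencil P Q}.
Proof.
move=> [_ Rdim Rcap Rtr] PQW n0 RP RQ RPQ U RU.
have [UW dU] := Rdim _ RU.
have [->|UQ] := eqVneq U (rowvs Q); first by rewrite mem_head.
have [->|UP] := eqVneq U (rowvs P).
  by have := @mem_pencil P Q 1 0; rewrite oner_eq0 scale1r scale0r addr0; apply.
have dP : \dim (rowvs P) = n by have [] := Rdim _ RP.
have nz (x : 'rV_n) : x != 0 -> x *m P != 0.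
  by apply: contra_neq => xP; have [] := @PQ x 0; rewrite ?xP ?mul0mx ?addr0.
have nzQ (x : 'rV_n) : x != 0 -> x *m Q != 0.
  by apply: contra_neq => xP; have [] := @PQ 0 x; rewrite ?xP ?mul0mx ?addr0.
have distinct : uniq [:: rowvs P; rowvs Q; rowvs (P + Q)].
  have := @pencil_cap 1 0 0 1; have := @pencil_cap 1 0 1 1; have := @pencil_cap 0 1 1 1.
  rewrite !(mul0r, mul1r, mulr0, subr0, sub0r, oppr_eq0) oner_eq0.
  rewrite !(scale1r, scale0r, addr0, add0r) => /(_ isT) c1 /(_ isT) c2 /(_ isT) c3.
  rewrite /= !inE negb_or !andbT; apply/andP; split; first (apply/andP; split).
  - by apply: contraTneq n0 => E; rewrite -dP -[rowvs P]capvv {2}E c3 dimv0.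
  - by apply: contraTneq n0 => E; rewrite -dP -[rowvs P]capvv {2}E c2 dimv0.
  - have [_ dQ] := Rdim _ RQ.
    by apply: contraTneq n0 => E; rewrite -dQ -[rowvs Q]capvv {2}E c1 dimv0.
(* The three given members are met in the points [x P], [x Q] and [x (P + Q)]. *)
have trl x : x != 0 -> is_transversal_line W R (<[x *m P]> + <[x *m Q]>)%VS.
  move=> x0; have xPW : x *m P \in W by rewrite -PQW (subvP (addvSl _ _)) ?rowvs_mul.
  have xQW : x *m Q \in W by rewrite -PQW (subvP (addvSr _ _)) ?rowvs_mul.
  have meetsI v U' : v != 0 -> v \in (<[x *m P]> + <[x *m Q]>)%VS -> v \in U' ->
      meets (<[x *m P]> + <[x *m Q]>)%VS U'.
    move=> v0 vl vU; rewrite /meets -subv0; apply: contra v0 => /subvP/(_ v).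
    by rewrite memv0 memv_cap vl vU => ->.
  have lP : x *m P \in (<[x *m P]> + <[x *m Q]>)%VS by rewrite memvE addvSl.
  have lQ : x *m Q \in (<[x *m P]> + <[x *m Q]>)%VS by rewrite memvE addvSr.
  split; first by rewrite subv_add -!memvE xPW.
    rewrite dimv_disjoint_sum ?dim_vline ?nz ?nzQ //.
    apply/eqP; rewrite -subv0; apply/subvP => v; rewrite memv_cap.
    case/andP=> /vlineP[k ->] /vlineP[k' E].
    have [] := @PQ (k *: x) (- k' *: x).
      by rewrite -!scalemxAl E scaleNr subrr.
    by rewrite scalemxAl => -> _; rewrite mul0mx mem0v.
  exists (rowvs P), (rowvs Q), (rowvs (P + Q)); split=> //.
    by move=> X; rewrite !inE => /or3P[] /eqP ->.
  rewrite /= (meetsI (x *m P)) ?nz ?rowvs_mul // (meetsI (x *m Q)) ?nzQ ?rowvs_mul //=.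
  rewrite andbT; apply: (meetsI (x *m (P + Q))); rewrite ?rowvs_mul //.
    by apply: contra_neq x0; rewrite mulmxDr => /PQ[].
  by rewrite mulmxDr rpredD.
(* The common point of [U] and this transversal has both coefficients nonzero, because [U] is skew
   to [rowvs Q] and to [rowvs P]. *)
have onl x : x != 0 -> exists2 a, a != 0 & x *m (P + a *: Q) \in U.
  move=> x0; have [/(_ _ RU) + _] := Rtr _ (trl _ x0).
  rewrite /meets -vpick0; have := memv_pick ((<[x *m P]> + <[x *m Q]>) :&: U)%VS.
  set u := vpick _; rewrite memv_cap => /andP[/memv_addP[_ /vlineP[a ->] [_ /vlineP[b ->] E]] uU] u0.
  have a0 : a != 0.
    apply: contraNneq u0 => a0; rewrite -memv0 -(Rcap _ _ RU RQ UQ) memv_cap uU E a0.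
    by rewrite scale0r add0r memvZ ?rowvs_mul.
  have b0 : b != 0.
    apply: contraNneq u0 => b0; rewrite -memv0 -(Rcap _ _ RU RP UP) memv_cap uU E b0.
    by rewrite scale0r addr0 memvZ ?rowvs_mul.
  exists (a^-1 * b); first by rewrite mulf_neq0 ?invr_eq0.
  rewrite mulmxDr -scalemxAr -[x *m P]scale1r -(mulVf a0) -!scalerA -scalerDr -E.
  exact: memvZ.
have uniqU (x y : 'rV_n) : x *m P + y *m Q \in U -> x = 0 -> y = 0.
  move=> + x0; rewrite x0 mul0mx add0r => yU.
  have := Rcap _ _ RU RQ UQ => /vspaceP/(_ (y *m Q)).
  rewrite memv_cap yU rowvs_mul memv0 => /esym/eqP yQ.
  by have [] := @PQ 0 y; rewrite ?mul0mx ?yQ ?addr0.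
(* The factor does not depend on the vector, by the argument that a linear map for which all vectors
   are eigenvectors is scalar: for non-proportional [x] and [y], compare both factors with that of
   [x + y]. *)
have scal_eq x y a b : x != 0 -> y != 0 -> x *m (P + a *: Q) \in U ->
    y *m (P + b *: Q) \in U -> a = b.
  move=> x0 y0 xU yU.
  have prop k : k != 0 -> y = k *: x -> a = b.
    move=> k0 yk; have := memvB (memvZ k xU) yU.
    have -> : k *: (x *m (P + a *: Q)) - y *m (P + b *: Q) =
        0 *m P + ((k * (a - b)) *: x) *m Q.
      rewrite yk mul0mx add0r -!scalemxAl -scalerBr !mulmxDr -!scalemxAr.
      by rewrite opprD addrACA subrr add0r -scalerBl scalerA.
    move/uniqU=> /(_ erefl)/eqP; rewrite scaler_eq0 (negPf x0) orbF mulf_eq0 (negPf k0).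
    by rewrite subr_eq0 => /eqP.
  have [xy|xy] := eqVneq (x + y) 0.
    apply: (prop (-1)); rewrite ?oppr_eq0 ?oner_eq0 // scaleN1r.
    by apply/eqP; rewrite -addr_eq0 addrC xy.
  have [c c0 cU] := onl _ xy.
  have := memvB (memvD xU yU) cU.
  have -> : x *m (P + a *: Q) + y *m (P + b *: Q) - (x + y) *m (P + c *: Q) =
     0 *m P + ((a - c) *: x + (b - c) *: y) *m Q.
    rewrite mul0mx add0r [in LHS]mulmxDl opprD addrACA -!mulmxBr.
    have PE e : P + e *: Q - (P + c *: Q) = (e - c) *: Q.
      by rewrite opprD addrACA subrr add0r scalerBl.
    by rewrite !PE mulmxDl -!scalemxAr -!scalemxAl.
  move/uniqU => /(_ erefl) D.
  have [ac|ac] := eqVneq a c.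
    move/eqP: D; rewrite ac subrr scale0r add0r scaler_eq0 (negPf y0) orbF subr_eq0.
    by move/eqP ->.
  have bc : b - c != 0.
    apply: contraNneq ac => bc; move/eqP: D.
    by rewrite bc scale0r addr0 scaler_eq0 (negPf x0) orbF subr_eq0.
  apply: (prop (- (b - c)^-1 * (a - c))).
    by rewrite mulf_neq0 ?oppr_eq0 ?invr_eq0 // subr_eq0.
  move/eqP: D; rewrite addr_eq0 => /eqP D.
  by rewrite mulNr scaleNr -scalerA D scalerN opprK scalerA mulVf // scale1r.
have e0 : const_mx 1 != 0 :> 'rV[F]_n.
  by apply/rV0Pn; exists (Ordinal n0); rewrite mxE oner_eq0.
have [a a0 aU] := onl _ e0.
suff -> : U = rowvs (1 *: P + a *: Q) by rewrite mem_pencil ?oner_eq0.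
rewrite scale1r; apply/esym/eqP; rewrite eqEdim dU; apply/andP; split.
  apply/subvP=> _ /mem_rowvsP[x ->].
  have [->|x0] := eqVneq x 0; first by rewrite mul0mx mem0v.
  by have [b b0 bU] := onl _ x0; rewrite (scal_eq _ _ _ _ e0 x0 aU bU).
rewrite dim_rowvs; have := @pencil_free 1 a; rewrite scale1r oner_eq0 => /(_ isT).
by move/eqP ->.
Qed.

End Independent.
End Pencil.

(** * The spreads induced by a generalized arc *)

Section RowvsSum.
Variables (F : finFieldType) (N : nat).

Lemma rowvs_col m1 m2 (A : 'M[F]_(m1, N)) (B : 'M[F]_(m2, N)) :
  rowvs (col_mx A B) = (rowvs A + rowvs B)%VS.
Proof.
apply/vspaceP => v; apply/mem_rowvsP/memv_addP => [[x ->]|].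
  exists (lsubmx x *m A); rewrite ?rowvs_mul //.
  exists (rsubmx x *m B); rewrite ?rowvs_mul //.
  by rewrite -mul_row_col hsubmxK.
case=> _ /mem_rowvsP[x ->] [_ /mem_rowvsP[y ->] ->].
by exists (row_mx x y); rewrite mul_row_col.
Qed.

Lemma card_vspace_rV (W : {vspace 'rV[F]_N}) : #|[set v | v \in W]| = (#|F| ^ \dim W)%N.
Proof.
have [M WM] := rowvs_exists W.
have fM : row_free M by rewrite /row_free -dim_rowvs -WM.
have -> : [set v | v \in W] = [set x *m M | x in [set: 'rV[F]_(\dim W)]].
  apply/setP => v; rewrite inE [in LHS]WM; apply/mem_rowvsP/imsetP.
    by case=> x ->; exists x; rewrite ?inE.
  by case=> x _ ->; exists x.
by rewrite card_imset ?cardsT ?card_mx ?mul1n //; apply: row_free_inj.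
Qed.

End RowvsSum.

Section Arc.

Variables (F : finFieldType) (n k : nat) (pi : 'I_k -> {vspace 'rV[F]_(3 * n)}).
Hypothesis n0 : (0 < n)%N.
Hypothesis k2 : (2 < k)%N.
Hypothesis arc : is_generalized_arc pi.

(** The [3 * n] rows span a space of dimension [3 * n], so they are independent. *)
Lemma full_indep3 (A B C : 'M[F]_(n, 3 * n)) :
  (rowvs A + rowvs B + rowvs C = fullv)%VS ->
  forall x y z : 'rV_n, x *m A + y *m B + z *m C = 0 -> [/\ x = 0, y = 0 & z = 0].
Proof.
move=> full x y z E.
have fr : row_free (col_mx (col_mx A B) C).
  by rewrite /row_free -dim_rowvs !rowvs_col full dimvf /dim /= mul1n !mulSn mul0n addn0 addnA.
have : row_mx (row_mx x y) z = 0.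
  by apply: (row_free_inj fr); rewrite mul0mx !mul_row_col.
by move=> /eqP; rewrite !row_mx_eq0 => /andP[/andP[/eqP -> /eqP ->] /eqP ->].
Qed.

Lemma arc_indep3 i j l (A B C : 'M[F]_(n, 3 * n)) : uniq [:: i; j; l] ->
  pi i = rowvs A -> pi j = rowvs B -> pi l = rowvs C ->
  forall x y z : 'rV_n, x *m A + y *m B + z *m C = 0 -> [/\ x = 0, y = 0 & z = 0].
Proof. by case: arc => _ _ full /full + E1 E2 E3; rewrite E1 E2 E3; apply: full_indep3. Qed.

Lemma arc_rowvs : {M : 'I_k -> 'M[F]_(n, 3 * n) | forall i, pi i = rowvs (M i)}.
Proof.
have dim_pi i : \dim (pi i) = n by case: arc.
by exists (fun i => sval (rowvs_dim (dim_pi i))) => i; case: (rowvs_dim _).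
Qed.

Lemma arc_dim j : \dim (pi j) = n. Proof. by case: arc. Qed.

(** The arc condition is about three elements; statements about two of them are reached by adding
    any third one. *)
Lemma exists_third (i j : 'I_k) : {l | i != j -> uniq [:: i; j; l]}.
Proof.
have : (0 < #|~: [set i; j]|)%N.
  by rewrite cardsCs setCK card_ord subn_gt0 (leq_ltn_trans _ k2) // cards2; case: (_ != _).
case/card_gt0P/sigW => l; rewrite !inE negb_or => /andP[li lj]; exists l => ij.
by rewrite /= !inE negb_or ij eq_sym li eq_sym lj.
Qed.

Lemma DeltaP i W U :
  reflect (exists2 j, j != i & U = ((pi i + pi j) :&: W)%VS) (U \in Delta pi i W).
Proof.
apply: (iffP mapP) => [[j]|[j ji ->]]; last by exists j; rewrite // mem_filter ji mem_enum.
by rewrite mem_filter => /andP[ji _] ->; exists j.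
Qed.

Section Projection.

Variables (i : 'I_k) (W : {vspace 'rV[F]_(3 * n)}).
Hypothesis dW : \dim W = (2 * n)%N.
Hypothesis Wpi : (W :&: pi i = 0)%VS.

(** The projection onto [W] with kernel [pi i], as a matrix: intersecting with [W] a space that
    contains [pi i] becomes right multiplication by it. *)
Definition proj_along : 'M[F]_(3 * n) := lin1_mx (daddv_pi W (pi i)).
Local Notation D := proj_along.

Lemma proj_along_full : (W + pi i = fullv)%VS.
Proof.
apply/eqP; rewrite eqEdim subvf dimv_disjoint_sum // dW dimvf /dim /= mul1n.
by case: arc => _ -> _; rewrite -[X in (_ + X)%N]mul1n -mulnDl.
Qed.

Lemma proj_along_mem v : v *m D \in W.
Proof. by rewrite mul_rV_lin1 memv_pi. Qed.

Lemma proj_along_id v : v \in W -> v *m D = v.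
Proof. by move=> vW; rewrite mul_rV_lin1 /= daddv_pi_id. Qed.

Lemma proj_along_sub v : v - v *m D \in pi i.
Proof.
have vf : v \in (W + pi i)%VS by rewrite proj_along_full memvf.
rewrite mul_rV_lin1 /= -{1}(daddv_pi_add Wpi vf) addrAC subrr add0r.
exact: memv_pi.
Qed.

Lemma proj_along_eq0 v : (v *m D == 0) = (v \in pi i).
Proof.
apply/idP/idP => [/eqP E|vp]; first by rewrite -[v]subr0 -E proj_along_sub.
rewrite -memv0 -Wpi memv_cap proj_along_mem /=.
by have := memvB vp (proj_along_sub v); rewrite subKr.
Qed.

Lemma proj_along_cap m (M : 'M[F]_(m, 3 * n)) :
  ((pi i + rowvs M) :&: W)%VS = rowvs (M *m D).
Proof.
apply/vspaceP => v; rewrite memv_cap; apply/andP/mem_rowvsP.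
  case=> /memv_addP[p pp [_ /mem_rowvsP[x ->] E]] vW; exists x.
  move: pp; rewrite -proj_along_eq0 => /eqP p0.
  by rewrite -(proj_along_id vW) E mulmxDl p0 add0r mulmxA.
case=> x ->; rewrite mulmxA proj_along_mem; split=> //.
rewrite -[_ *m D](subKr (x *m M)) addrC memv_add ?rowvs_mul //.
by rewrite memvN proj_along_sub.
Qed.

Lemma proj_along_add m (M : 'M[F]_(m, 3 * n)) :
  (pi i + rowvs (M *m D) = pi i + rowvs M)%VS.
Proof.
rewrite -proj_along_cap; apply/eqP; rewrite eqEsubv subv_add addvSl capvSl /=.
rewrite subv_add addvSl proj_along_cap /=; apply/subvP=> _ /mem_rowvsP[x ->].
rewrite -(subrK (x *m M *m D) (x *m M)) memv_add ?proj_along_sub //.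
by rewrite -mulmxA rowvs_mul.
Qed.

(** A space through [pi i] is the sum of [pi i] and its trace on [W], so the trace determines it. *)
Lemma proj_along_inj (A B : {vspace 'rV[F]_(3 * n)}) :
  ((pi i + A) :&: W = (pi i + B) :&: W)%VS -> (pi i + A = pi i + B)%VS.
Proof.
have [MA ->] := rowvs_exists A; have [MB ->] := rowvs_exists B.
by rewrite !proj_along_cap -(proj_along_add MA) -(proj_along_add MB) => ->.
Qed.

Lemma Delta_free j (M : 'M[F]_(n, 3 * n)) : j != i -> pi j = rowvs M -> row_free (M *m D).
Proof.
move=> ji E; apply: inj_row_free => x /eqP; rewrite mulmxA proj_along_eq0.
have [Mi Ei] := arc_rowvs; rewrite Ei => /mem_rowvsP[y yE].
have [l lE] := exists_third i j; have [Ml El] := rowvs_dim (arc_dim l).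
have ijl : uniq [:: i; j; l] by apply: lE; rewrite eq_sym.
have [|_ -> _] // := arc_indep3 ijl (Ei i) E El (x := - y) (y := x) (z := 0).
by rewrite mul0mx addr0 mulNmx addrC -yE subrr.
Qed.

Lemma Delta_cap j l : j != i -> l != i -> j != l ->
  (((pi i + pi j) :&: W) :&: ((pi i + pi l) :&: W) = 0)%VS.
Proof.
move=> ji li jl; apply/eqP; rewrite -subv0; apply/subvP => v.
have [Mi Ei] := rowvs_dim (arc_dim i).
have [Mj Ej] := rowvs_dim (arc_dim j).
have [Ml El] := rowvs_dim (arc_dim l).
rewrite memv_cap Ej El !proj_along_cap => /andP[/mem_rowvsP[x ->] /mem_rowvsP[y]].
move/eqP; rewrite !mulmxA -subr_eq0 -mulmxBl proj_along_eq0 Ei => /mem_rowvsP[z zE].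
have ijl : uniq [:: i; j; l] by rewrite /= !inE negb_or eq_sym ji eq_sym li jl.
have [|_ -> _] := arc_indep3 ijl Ei Ej El (x := - z) (y := x) (z := - y).
  by rewrite !mulNmx -zE -addrA addNr.
by rewrite !mul0mx mem0v.
Qed.

(** The members are pairwise skew, and there are q^n + 1 of them with q^n - 1 nonzero vectors each.
    These are q^(2n) - 1 vectors, all the nonzero vectors of [W]. *)
Lemma Delta_spread : k = (#|F| ^ n + 2)%N -> is_spread n W (Delta pi i W).
Proof.
move=> kE; have [M ME] := arc_rowvs; split=> [U /DeltaP[j ji ->]|v vW v0].
  split; first exact: capvSr.
  by rewrite (ME j) proj_along_cap dim_rowvs; apply/eqP/(Delta_free ji).
(* A pair of an index [j] and a nonzero coefficient vector stands for a nonzero vector of the member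
   with index [j]. *)
pose X := [set jx : 'I_k * 'rV[F]_n | (jx.1 != i) && (jx.2 != 0)].
pose f (jx : 'I_k * 'rV[F]_n) := jx.2 *m (M jx.1 *m D).
have DjE j : ((pi i + pi j) :&: W)%VS = rowvs (M j *m D) by rewrite (ME j) proj_along_cap.
have inf jx : f jx \in ((pi i + pi jx.1) :&: W)%VS by rewrite DjE rowvs_mul.
have f0 jx : jx \in X -> f jx != 0.
  rewrite inE => /andP[ji]; apply: contra_neq => E.
  by apply: (row_free_inj (Delta_free ji (ME _))); rewrite mul0mx.
have finj : {in X &, injective f}.
  move=> [j x] [l y] Xj Xl E.
  have := f0 _ Xj; move: Xj Xl; rewrite !inE /= => /andP[ji x0] /andP[li y0] fx0.
  have [jl|jl] := eqVneq j l.
    move: E; rewrite /f jl /= => /(row_free_inj (Delta_free li (ME _))) -> //.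
  case/negP: fx0; rewrite -memv0 -(Delta_cap ji li jl) memv_cap inf E.
  exact: inf.
have : f @: X = [set w | w \in W] :\ 0.
  apply/eqP; rewrite eqEcard; apply/andP; split.
    apply/subsetP => _ /imsetP[jx jxX ->]; rewrite !inE f0 //=.
    by have := inf jx; rewrite memv_cap => /andP[].
  rewrite card_in_imset //.
  have -> : X = setX [set~ i] [set~ 0] by apply/setP => -[j x]; rewrite !inE.
  rewrite cardsX !cardsC1 card_ord card_mx mul1n.
  rewrite -(leq_add2l ((0 : 'rV[F]_(3 * n)) \in [set w | w \in W])) -cardsD1.
  rewrite inE mem0v card_vspace_rV dW kE mulnC expnM addn2 /= -mulnn.
  case: (#|F| ^ n)%N (expn_gt0 #|F| n) => [|q] _; first by rewrite muln0.
  by rewrite /= -(leq_add2r 0) addn0; lia.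
move=> /setP/(_ v); rewrite !inE v0 vW => /imsetP[[j x] jX vE].
exists ((pi i + pi j) :&: W)%VS; split.
  rewrite vE (inf (j, x)) andbT; apply/DeltaP; exists j => //.
  by move: jX; rewrite inE => /andP[].
move=> _ /andP[/DeltaP[l li ->] vl]; have [-> //|jl] := eqVneq j l.
have ji : j != i by move: jX; rewrite inE => /andP[].
case/negP: v0; rewrite -memv0 -(Delta_cap ji li jl) memv_cap vl andbT vE.
exact: (inf (j, x)).
Qed.

(* Closure of a regular [Delta] under reguli, read modulo [pi i]. *)
Lemma regular_pencil j l t (P Q : 'M[F]_(n, 3 * n)) (a : F) :
  is_regular_spread n W (Delta pi i W) ->
  j != i -> l != i -> t != i -> uniq [:: j; l; t] ->
  (pi i + rowvs P = pi i + pi j)%VS -> (pi i + rowvs Q = pi i + pi l)%VS ->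
  (pi i + rowvs (P + Q) = pi i + pi t)%VS ->
  exists2 m, m != i & (pi i + rowvs (P + a *: Q) = pi i + pi m)%VS.
Proof.
move=> [_ reg] ji li ti jlt EP EQ ES.
have dD j' (M : 'M_(n, _)) : j' != i -> (pi i + rowvs M = pi i + pi j')%VS ->
    \dim (rowvs (M *m D)) = n.
  move=> ji' E; have [M' EM] := rowvs_dim (arc_dim j').
  rewrite -proj_along_cap E EM proj_along_cap dim_rowvs; apply/eqP.
  exact: (Delta_free ji').
have fr j' (M : 'M_(n, _)) : j' != i -> (pi i + rowvs M = pi i + pi j')%VS -> row_free (M *m D).
  by move=> ji' /(dD _ _ ji'); rewrite dim_rowvs => E; rewrite /row_free E.
have memD j' (M : 'M_(n, _)) : j' != i -> (pi i + rowvs M = pi i + pi j')%VS ->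
    rowvs (M *m D) \in Delta pi i W.
  by move=> ji' E; apply/DeltaP; exists j' => //; rewrite -E proj_along_cap.
have jl : j != l by move: jlt; rewrite /= inE negb_or => /andP[/andP[]].
have ind : indep2 (P *m D) (Q *m D).
  apply: indep2_cap; [|exact: fr EP|exact: fr EQ].
  by rewrite -!proj_along_cap EP EQ Delta_cap.
have sW (M : 'M_(n, _)) : (rowvs (M *m D) <= W)%VS.
  by rewrite -proj_along_cap capvSr.
have inj j1 j2 : j1 != i -> j2 != i -> ((pi i + pi j1) :&: W = (pi i + pi j2) :&: W)%VS -> j1 = j2.
  move=> i1 i2 E; apply/eqP; apply: contraTT n0 => j12.
  have [M' EM] := rowvs_dim (arc_dim j1).
  have := Delta_cap i1 i2 j12; rewrite -E capvv EM proj_along_cap => Z.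
  have := Delta_free i1 EM; rewrite /row_free -dim_rowvs Z dimv0 => /eqP <-.
  by [].
(* The projected generators span a pencil, which is a regulus with three members in [Delta];
   regularity puts its member with parameter [a] there too. *)
have /DeltaP[m mi] : rowvs (P *m D + a *: (Q *m D)) \in Delta pi i W.
  apply: (reg (rowvs (P *m D)) (rowvs (Q *m D)) (rowvs ((P + Q) *m D)) _ _ _
            (pencil_regulus ind n0 (sW _) (sW _))).
  - rewrite -!proj_along_cap EP EQ ES; move: jlt; rewrite /= !inE !negb_or !andbT.
    case/andP=> /andP[_ jt] lt; apply/andP; split; first (apply/andP; split).
    + by apply: contra_neq jl; exact: inj.
    + by apply: contra_neq jt; exact: inj.
    + by apply: contra_neq lt; exact: inj.
  - move=> U; rewrite !inE => /or3P[] /eqP ->.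
    + exact: memD EP.
    + exact: memD EQ.
    + exact: memD ES.
  - move=> U; rewrite !in_cons in_nil orbF => /or3P[] /eqP ->.
    + have := @mem_pencil _ _ _ (P *m D) (Q *m D) 1 0.
      by rewrite scale1r scale0r addr0 oner_eq0; apply.
    + exact: mem_head.
    + have := @mem_pencil _ _ _ (P *m D) (Q *m D) 1 1.
      by rewrite !scale1r oner_eq0 mulmxDl; apply.
  - have := @mem_pencil _ _ _ (P *m D) (Q *m D) 1 a.
    by rewrite scale1r oner_eq0; apply.
rewrite scalemxAl -mulmxDl -proj_along_cap => E; exists m => //.
exact: proj_along_inj E.
Qed.

End Projection.
End Arc.

(** * Slope sets of regular spreads *)

Lemma affine_combE (F : nzRingType) (V : lmodType F) (x y : V) (c : F) :
  x + c *: (y - x) = (1 - c) *: x + c *: y.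
Proof. by rewrite scalerBr scalerBl scale1r addrCA addrC. Qed.

Section RegularSets.

Variables (F : fieldType) (A : unitAlgType F).
Implicit Types (C : {pred A}) (a b s t x : A).

(* The slopes, other than infinity, of a regular spread: [regset_line] is
   closure under the reguli through infinity, [regset_inv] under those through
   the slope 0. *)
Record regset C : Prop := RegSet {
  regset0 : 0 \in C;
  regset_line : forall a b (c : F), a \in C -> b \in C -> a + c *: (b - a) \in C;
  regset_diff : forall a b, a \in C -> b \in C -> a != b -> a - b \is a GRing.unit;
  regset_inv : forall a b (c : F), a \in C -> b \in C -> a != 0 -> b != 0 ->
    let m := a^-1 + c *: (b^-1 - a^-1) in
    m != 0 -> m \is a GRing.unit /\ m^-1 \in C }.

Variables (C : {pred A}) (c : F).
Hypotheses (c0 : c != 0) (c1 : c != 1) (rC : regset C).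

Let c1' : 1 - c != 0. Proof. by rewrite subr_eq0 eq_sym. Qed.

Lemma regsetZ d a : a \in C -> d *: a \in C.
Proof. by move=> aC; have := regset_line rC d (regset0 rC) aC; rewrite subr0 add0r. Qed.

(** The sum is the affine combination of [a / (1 - c)] and [b / c] with weights [1 - c] and [c];
    this is why a scalar [c] other than 0 and 1 is fixed. *)
Lemma regsetD a b : a \in C -> b \in C -> a + b \in C.
Proof.
move=> aC bC.
have := regset_line rC c (regsetZ (1 - c)^-1 aC) (regsetZ c^-1 bC).
by rewrite affine_combE !scalerA !mulfV // !scale1r.
Qed.

Lemma regsetN a : a \in C -> - a \in C.
Proof. by move=> aC; rewrite -scaleN1r regsetZ. Qed.

Lemma regsetB a b : a \in C -> b \in C -> a - b \in C.
Proof. by move=> aC bC; rewrite regsetD ?regsetN. Qed.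

Lemma regset_unit a : a \in C -> a != 0 -> a \is a GRing.unit.
Proof. by move=> aC a0; have := regset_diff rC aC (regset0 rC) a0; rewrite subr0. Qed.

(** The same device as for sums, applied to the inverses of [(1 - c) a] and [c b]. *)
Lemma regset_invD a b : a \in C -> b \in C -> a != 0 -> b != 0 -> a^-1 + b^-1 != 0 ->
  (a^-1 + b^-1)^-1 \in C.
Proof.
move=> aC bC a0 b0 ab0.
have := @regset_inv _ rC ((1 - c) *: a) (c *: b) c (regsetZ _ aC) (regsetZ _ bC).
have ua := regset_unit aC a0; have ub := regset_unit bC b0.
rewrite /= !scaler_eq0 (negPf c0) (negPf c1') (negPf a0) (negPf b0) /=.
rewrite !invrZ ?unitfE //.
have -> : (1 - c)^-1 *: a^-1 + c *: (c^-1 *: b^-1 - (1 - c)^-1 *: a^-1) = a^-1 + b^-1.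
  by rewrite affine_combE !scalerA !mulfV // !scale1r.
by move=> /(_ isT isT ab0)[].
Qed.

(** Normalisation: dividing on the left by a nonzero member [s] gives a set of the same kind that
    contains 1. *)
Lemma regset_shift s : s \in C -> s != 0 -> regset [pred x | s * x \in C].
Proof.
move=> sC s0; have us := regset_unit sC s0.
have ne0 a : (s * a != 0) = (a != 0).
  apply/idP/idP; apply: contra_neq; first by move=> ->; rewrite mulr0.
  by move=> E; rewrite -[a](mulKr us) E mulr0.
split=> [|a b d|a b|a b d]; rewrite ?inE ?mulr0 ?(regset0 rC) //.
- by move=> aC bC; rewrite mulrDr -scalerAr mulrBr (regset_line rC).
- move=> aC bC ab; have := regset_diff rC aC bC.
  rewrite -mulrBr unitrMr //; apply.
  by rewrite -subr_eq0 -mulrBr ne0 subr_eq0.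
- move=> aC bC a0 b0 m m0.
  have ua : a \is a GRing.unit by rewrite -(unitrMr _ us) regset_unit // ne0.
  have ub : b \is a GRing.unit by rewrite -(unitrMr _ us) regset_unit // ne0.
  have := @regset_inv _ rC (s * a) (s * b) d aC bC; rewrite !ne0 /= !invrM // -mulrBl scalerAl -mulrDl.
  rewrite -/m => /(_ a0 b0) [|u mC].
    by apply: contra_neq m0 => E; rewrite -[m](mulrVK us) E mul0r.
  rewrite unitrMl ?unitrV // in u.
  by split=> //; rewrite inE; move: mC; rewrite invrM ?unitrV // invrK.
Qed.

Hypothesis C1 : 1 \in C.

(** With y = x - 1 one has (y^-1 + 1)^-1 = x^-1 y = 1 - x^-1, and the left side lies in [C]. *)
Lemma regsetV x : x \in C -> x != 0 -> x^-1 \in C.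
Proof.
move=> xC x0; have [->|x1] := eqVneq x 1; first by rewrite invr1.
have ux := regset_unit xC x0.
have yC : x - 1 \in C by rewrite regsetB.
have y0 : x - 1 != 0 by rewrite subr_eq0.
have uy := regset_unit yC y0.
have E : (x - 1)^-1 + 1^-1 = (x - 1)^-1 * x.
  by apply: (mulrI uy); rewrite mulrDr mulrA mulrV // mul1r invr1 mulr1 addrC subrK.
have := regset_invD yC C1 y0 (oner_neq0 _).
rewrite E invrM ?unitrV // invrK.
have -> : (x - 1)^-1 * x != 0.
  apply: contra_neq x0 => Z; by rewrite -[x](mulVKr uy) Z mulr0.
move=> /(_ isT); rewrite mulrBr mulVr // mulr1 => H.
by rewrite -[x^-1](subKr 1) regsetB.
Qed.

(* Hua's identity: (a^-1 + (b^-1 - a)^-1)^-1 = a - a b a *)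
Lemma regset_hua a b : a \in C -> b \in C -> a * b * a \in C.
Proof.
move=> aC bC; have [->|a0] := eqVneq a 0; first by rewrite !mul0r regset0.
have [->|b0] := eqVneq b 0; first by rewrite mulr0 mul0r regset0.
have ua := regset_unit aC a0; have ub := regset_unit bC b0.
have [ba|ba] := eqVneq b^-1 a; first by rewrite -ba mulVr // mul1r ba.
have yC : b^-1 - a \in C by rewrite regsetB ?regsetV.
have y0 : b^-1 - a != 0 by rewrite subr_eq0.
have uy := regset_unit yC y0.
have E : a^-1 + (b^-1 - a)^-1 = a^-1 * b^-1 * (b^-1 - a)^-1.
  rewrite -{1}[a^-1](mulrK uy) -{2}[(b^-1 - a)^-1]mul1r -mulrDl mulrBr mulVr //.
  by rewrite subrK.
have := regset_invD aC yC a0 y0; rewrite E.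
have uab : a^-1 * b^-1 \is a GRing.unit by rewrite unitrMl unitrV.
have uE : a^-1 * b^-1 * (b^-1 - a)^-1 \is a GRing.unit by rewrite unitrMl ?unitrV.
have -> : a^-1 * b^-1 * (b^-1 - a)^-1 != 0.
  by apply: contraTneq uE => ->; rewrite unitr0.
move=> /(_ isT); rewrite !invrM ?unitrV // !invrK.
rewrite mulrA mulrBl mulVr // mulrBl mul1r => H.
by rewrite -[a * b * a](subKr a) regsetB.
Qed.

(** Hua's identity with [a = t] and [b = t ^+ k] gives the power [k + 2], so the induction carries
    two consecutive powers. *)
Lemma regsetX t k : t \in C -> t ^+ k \in C.
Proof.
move=> tC; suff : t ^+ k \in C /\ t ^+ k.+1 \in C by case.
elim: k => [|k [IH1 IH2]]; first by rewrite expr0 expr1.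
by split=> //; rewrite exprS exprSr mulrA regset_hua.
Qed.

End RegularSets.

(** * Fields generated by a matrix *)

Section MinpolyDegree.

Variables (F : fieldType) (n : nat) (t : 'M[F]_n.+1).
Hypothesis unit_t : forall p, horner_mx t p != 0 -> horner_mx t p \in unitmx.
Local Notation d := (degree_mxminpoly t).

(** If a nonconstant factor [p] did not vanish at [t], then [p(t)] would be invertible and the
    cofactor, of smaller degree, would vanish at [t]. *)
Lemma mxminpoly_irreducible : irreducible_poly (mxminpoly t).
Proof.
split=> [|p p1 /dvdpP[r E]].
  by rewrite size_mxminpoly ltnS mxminpoly_nonconstant.
have nzm : mxminpoly t != 0 by rewrite -size_poly_eq0 size_mxminpoly.
have pm : p %| mxminpoly t by rewrite E dvdp_mull.
rewrite /eqp pm /= dvd_mxminpoly; apply: contraT => /unit_t up.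
have /eqP : horner_mx t (mxminpoly t) = 0 by apply: mx_root_minpoly.
rewrite E rmorphM /= -[X in X == _]/(horner_mx t r *m horner_mx t p).
move=> /eqP/(congr1 (mulmx^~ (invmx (horner_mx t p)))).
rewrite mulmxK // mul0mx => /eqP; rewrite -dvd_mxminpoly => mr.
have r0 : r != 0 by apply: contraNneq nzm => r0; rewrite E r0 mul0r.
have p0 : p != 0 by apply: contraNneq nzm => p0; rewrite E p0 mulr0.
have := dvdp_leq r0 mr; rewrite E size_mul //.
move: p1; rewrite -size_poly_gt0 -size_poly_gt0 in r0 p0.
case: (size p) p0 => [|[|sp]] // _ _; rewrite addnS /= ; lia.
Qed.

(* [F[t]] is a field acting freely on the nonzero vectors, so a maximal
   [t]-stable space whose dimension is a multiple of [d] is the whole space. *)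
Lemma degree_mxminpoly_dvd : (d %| n.+1)%N.
Proof.
suff step m : (m <= n.+1)%N -> exists X : 'M[F]_n.+1,
    [/\ stablemx X t, (d %| \rank X)%N & (m <= \rank X)%N].
  have [X [_ dX rX]] := step _ (leqnn _).
  suff <- : \rank X = n.+1 by [].
  by apply/eqP; rewrite eqn_leq rank_leq_row.
elim: m => [|m IH] mn.
  by exists 0; rewrite mxrank0 dvdn0 mul0mx sub0mx.
have [X [sX dX rX]] := IH (ltnW mn).
have [rm|rm] := ltnP m (\rank X); first by exists X.
have [u uX] : exists u : 'rV_n.+1, ~~ (u <= X)%MS.
  have /row_subPn[i iX] : ~~ (1%:M <= X)%MS.
    by rewrite sub1mx /row_full neq_ltn (leq_ltn_trans rm mn).
  by exists (row i 1%:M).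
(* The rows u, u t, ..., u t^(d-1) span the cyclic space [u F[t]]. *)
pose K : 'M[F]_(d, n.+1) := powers_mx t d *m lin_mul_row u.
have KE (x : 'rV_d) : x *m K = u *m horner_mx t (rVpoly x).
  by rewrite mulmxA -[x *m _]vec_mxK mul_vec_lin_row -horner_rVpoly.
have memK p : (u *m horner_mx t p <= K)%MS.
  apply/submxP; exists (poly_rV (p %% mxminpoly t)).
  by rewrite KE poly_rV_K ?size_mod_mxminpoly // -horner_mxK mx_inv_hornerK ?horner_mx_mem.
have sXp p : (X *m horner_mx t p <= X)%MS.
  elim/poly_ind: p => [|p c IHp]; first by rewrite rmorph0 mulmx0 sub0mx.
  rewrite rmorphD rmorphM /= horner_mx_X horner_mx_C mulmxDr addmx_sub //.
    by rewrite -[_ * t]/(_ *m t) mulmxA (submx_trans (submxMr t IHp)).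
  by rewrite mul_mx_scalar scalemx_sub.
(* If [u h(t)] is a nonzero vector of [X], then [h(t)] is invertible and maps [X] onto itself, so
   [u] would lie in [X]. *)
have capK : (X :&: K = 0)%MS.
  apply/eqP; rewrite -submx0; apply/rV_subP => w; rewrite sub_capmx.
  case/andP=> wX /submxP[x wx]; rewrite wx KE.
  have [->|h0] := eqVneq (horner_mx t (rVpoly x)) 0; first by rewrite mulmx0 sub0mx.
  have uh := unit_t h0; case/negP: uX.
  have XE : (X <= X *m horner_mx t (rVpoly x))%MS.
    rewrite -(geq_leqif (mxrank_leqif_sup (sXp _))) mxrankMfree //.
    by rewrite row_free_unit.
  have := submx_trans wX XE; rewrite wx KE => /(submxMr (invmx (horner_mx t (rVpoly x)))).
  by rewrite !mulmxK.
have fK : row_free K.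
  apply: inj_row_free => x; rewrite KE => /eqP hx.
  apply: (@horner_rVpoly_inj _ _ t); rewrite /= linear0 rmorph0.
  apply/eqP; apply: contraNT uX => /unit_t uh.
  by rewrite -[u](mulmxK uh) (eqP hx) mul0mx sub0mx.
exists (X + K)%MS; have -> : \rank (X + K)%MS = (\rank X + d)%N.
  by rewrite mxrank_disjoint_sum // (eqP fK).
split.
- rewrite addsmxMr addsmxS //; apply/rV_subP => w /submxP[x ->].
  have E : horner_mx t (rVpoly x * 'X) = horner_mx t (rVpoly x) *m t.
    by rewrite rmorphM /= horner_mx_X.
  by rewrite mulmxA KE -mulmxA -E memK.
- by rewrite dvdn_addl.
- by have := mxminpoly_nonconstant t; lia.
Qed.

End MinpolyDegree.

Section MatrixRegset.

Variables (F : finFieldType) (n : nat).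
Hypothesis pn : prime n.+1.
Hypothesis q2 : (2 < #|F|)%N.

Lemma exists_not01 : exists2 c : F, c != 0 & c != 1.
Proof.
have : (0 < #|~: [set (0%R : F); (1%R : F)]|)%N.
  by rewrite cardsCs setCK subn_gt0 cards2 eq_sym oner_eq0.
by case/card_gt0P=> c; rewrite !inE negb_or => /andP[c0 c1]; exists c.
Qed.

(** Differences of distinct members are invertible, so a member is determined by the image of one
    nonzero vector. *)
Lemma card_regset (C : {pred 'M[F]_n.+1}) : regset C -> (#|C| <= #|F| ^ n.+1)%N.
Proof.
move=> rC; rewrite -[X in (_ ^ X)%N]mul1n -card_mx.
have inj : {in C &, injective (fun a : 'M_n.+1 => (const_mx 1 : 'rV[F]_n.+1) *m a)}.
  move=> a b aC bC; apply: contra_eq => /(regset_diff rC aC bC) u.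
  rewrite -subr_eq0 -mulmxBr; apply/eqP.
  move=> /(congr1 (mulmx^~ (invmx (a - b)))); rewrite mulmxK // mul0mx.
  by move=> /rowP/(_ 0)/eqP; rewrite !mxE oner_eq0.
by rewrite -(card_in_image inj) max_card.
Qed.

Section Generator.

Variables (C : {pred 'M[F]_n.+1}) (t : 'M[F]_n.+1).
Hypotheses (rC : regset C) (C1 : 1 \in C) (tC : t \in C) (nst : ~~ is_scalar_mx t).

Lemma regset_horner p : horner_mx t p \in C.
Proof.
have [c c0 c1] := exists_not01.
rewrite -[p]coefK poly_def rmorph_sum /=; apply: (big_ind (fun a => a \in C)) => [|a b|i _].
- exact: regset0.
- exact: (regsetD c0 c1 rC).
- rewrite horner_mxZ rmorphXn /= horner_mx_X; apply: (regsetZ rC).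
  exact: (regsetX c0 c1 rC C1).
Qed.

Lemma regset_horner_unit p : horner_mx t p != 0 -> horner_mx t p \in unitmx.
Proof. by move=> h0; apply: (regset_unit rC) h0; apply: regset_horner. Qed.

(** The degree divides the prime [n.+1], and degree 1 would make [t] scalar. *)
Lemma regset_degree : degree_mxminpoly t = n.+1.
Proof.
have := degree_mxminpoly_dvd regset_horner_unit.
case/primeP: pn => _ H /H /orP[/eqP d1|/eqP //].
by case/negP: nst; rewrite -mxminpoly_linear_is_scalar d1.
Qed.

(** [F[t]] lies in [C] and already has q^(n+1) elements, the most that [C] can have. *)
Lemma regset_gen a : a \in C -> exists p, a = horner_mx t p.
Proof.
pose K := [set horner_mx t (rVpoly x) | x in [set: 'rV[F]_(degree_mxminpoly t)]].
have KC : K = [set a in C].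
  apply/eqP; rewrite eqEcard; apply/andP; split.
    by apply/subsetP => _ /imsetP[x _ ->]; rewrite inE regset_horner.
  rewrite card_imset; last exact: horner_rVpoly_inj.
  by rewrite cardsT card_mx mul1n regset_degree cardsE card_regset.
move=> aC; have : a \in K by rewrite KC inE.
by case/imsetP=> x _ ->; exists (rVpoly x).
Qed.

End Generator.

(** Divided by [s], both sets contain 1 and [s^-1 * t]; the first is then [F[s^-1 t]], which the
    second contains. *)
Lemma regset_sub (C C' : {pred 'M[F]_n.+1}) s t : regset C -> regset C' ->
  s \in C -> s \in C' -> t \in C -> t \in C' -> s != 0 -> ~~ is_scalar_mx (s^-1 * t) ->
  {subset C <= C'}.
Proof.
move=> rC rC' sC sC' tC tC' s0 nst a aC.
have us := regset_unit rC sC s0.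
have st : s * (s^-1 * t) = t by rewrite mulVKr.
have [p E] : exists p, s^-1 * a = horner_mx (s^-1 * t) p.
  apply: (regset_gen (regset_shift rC sC s0)) => //.
  - by rewrite inE mulr1.
  - by rewrite inE st.
  - by rewrite inE mulVKr.
have := @regset_horner [pred x | s * x \in C'] (s^-1 * t) (regset_shift rC' sC' s0) _ _ p.
by rewrite !inE -E mulr1 !mulVKr //; apply.
Qed.

Lemma regset_eq (C C' : {pred 'M[F]_n.+1}) s t : regset C -> regset C' ->
  s \in C -> s \in C' -> t \in C -> t \in C' -> s != 0 -> ~~ is_scalar_mx (s^-1 * t) ->
  C =i C'.
Proof.
move=> rC rC' sC sC' tC tC' s0 ns a; apply/idP/idP.
  exact: (regset_sub rC rC' sC sC' tC tC' s0 ns).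
exact: (regset_sub rC' rC sC' sC tC' tC s0 ns).
Qed.

End MatrixRegset.

(** * Line-preserving maps *)

Section Collinear.

Variables (F : fieldType) (X : lmodType F).
Implicit Types (a b x y z : X).

Definition on_line a b x := exists c : F, x = a + c *: (b - a).

Lemma on_linel a b : on_line a b a.
Proof. by exists 0; rewrite scale0r addr0. Qed.

Lemma on_liner a b : on_line a b b.
Proof. by exists 1; rewrite scale1r addrC subrK. Qed.

Lemma on_line_change a b x y z : x != y ->
  on_line a b x -> on_line a b y -> on_line a b z -> on_line x y z.
Proof.
move=> xy [c xE] [d yE] [e ->].
have dc : d - c != 0.
  by apply: contra_neq xy => /eqP; rewrite subr_eq0 xE yE => /eqP ->.
exists ((e - c) / (d - c)).
rewrite xE yE opprD addrACA subrr add0r -scalerBl scalerA divfK // -addrA -scalerDl.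
by rewrite [c + _]addrC subrK.
Qed.

End Collinear.

Section LinePreserving.

Variables (F : finFieldType) (X Y : lmodType F) (C G : {pred X}) (f : X -> Y).
Hypothesis q2 : (2 < #|F|)%N.
Hypotheses (C0 : 0 \in C) (CD : forall a b, a \in C -> b \in C -> a + b \in C).
Hypothesis CZ : forall (c : F) a, a \in C -> c *: a \in C.
Hypothesis finj : {in C &, injective f}.
Hypothesis fC : forall a b y, a \in C -> b \in C -> on_line (f a) (f b) y ->
  exists2 x, x \in C & y = f x.
Hypothesis fG : forall a b x, a \in G -> b \in G -> a != b ->
  on_line a b x -> on_line (f a) (f b) (f x).
Hypothesis few : forall a b, a \in C -> b \in C -> a != b ->
  (exists x y, [/\ x != y, x \in G, y \in G, on_line a b x & on_line a b y]) \/
  (forall x, x \in C -> ~ on_line a b x -> x \in G).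

Lemma mem_on_line a b x : a \in C -> b \in C -> on_line a b x -> x \in C.
Proof.
by move=> aC bC [c ->]; rewrite CD // CZ // CD // -scaleN1r CZ.
Qed.

(* An injective map between two lines is onto because [F] is finite. *)
Lemma on_line_surj a b y : a \in C -> b \in C -> a != b ->
  (forall x, on_line a b x -> on_line (f a) (f b) (f x)) ->
  on_line (f a) (f b) y -> exists2 x, on_line a b x & y = f x.
Proof.
move=> aC bC ab H [m ->].
have /fin_all_exists[g gE] (c : F) : exists d : F, f (a + c *: (b - a)) = f a + d *: (f b - f a).
  by apply: H; exists c.
have ginj : injective g.
  move=> c d cd; have : f (a + c *: (b - a)) = f (a + d *: (b - a)) by rewrite !gE cd.
  move/finj => /(_ _ _)/addrI E; apply/eqP; rewrite -subr_eq0.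
  have : (c - d) *: (b - a) == 0.
    rewrite scalerBl subr_eq0; apply/eqP; apply: E.
      by apply: (mem_on_line aC bC); exists c.
    by apply: (mem_on_line aC bC); exists d.
  by rewrite scaler_eq0 [b - a == 0]subr_eq0 [b == a]eq_sym (negPf ab) orbF.
have [h gh hg] := injF_bij ginj.
exists (a + h m *: (b - a)); first by exists (h m).
by rewrite gE hg.
Qed.

(** A line with two points in [G] is mapped into a line by [fG]. Otherwise all points of [C] off the
    line are in [G]. Then the preimages of the points on the image line are shown to lie on the
    given line, and a count of parameters turns this round. *)
Lemma on_line_all a b x : a \in C -> b \in C -> a != b ->
  on_line a b x -> on_line (f a) (f b) (f x).
Proof.
move=> aC bC ab abx.
have fneq u v : u \in C -> v \in C -> u != v -> f u != f v.
  by move=> uC vC; apply: contra_neq; apply: finj.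
have [[p [p' [pp pG pG' abp abp']]]|out] := few aC bC ab.
  apply: (on_line_change (fneq _ _ aC bC ab) (a := f p) (b := f p')); apply: fG => //.
  - exact: on_line_change pp abp abp' (on_linel _ _).
  - exact: on_line_change pp abp abp' (on_liner _ _).
  - exact: on_line_change pp abp abp' abx.
have inL y : on_line (f a) (f b) y -> exists c : F, y = f (a + c *: (b - a)).
  move=> yl; have [r rC ry] := fC aC bC yl.
  suff [c rc] : on_line a b r by exists c => //; rewrite -rc.
  have [->|ra] := eqVneq r a; first exact: on_linel.
  case: (boolP [exists c : F, r == a + c *: (b - a)]) => [/existsP[c /eqP]|nrl].
    by exists c.
  have rl : ~ on_line a b r by move=> [c rE]; case/existsP: nrl; exists c; apply/eqP.
  (* Suppose that [r] is off the line. A third point [r'] of the line through [a] and [r] exists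
     because q > 2, and both [r] and [r'] are in [G]. *)
  have [c c0 c1] := exists_not01 q2.
  have [r' ar'] : exists r', r' = a + c *: (r - a) by eexists.
  have arr' : on_line a r r' by exists c.
  have rC' : r' \in C by apply: mem_on_line arr'.
  have rneq : r != r'.
    have -> : r = a + 1 *: (r - a) by rewrite scale1r addrC subrK.
    rewrite ar' (inj_eq (addrI a)) -subr_eq0 -scalerBl scaler_eq0 negb_or.
    by rewrite !subr_eq0 eq_sym c1.
  have r'a : a != r'.
    rewrite ar' -[X in X != _]addr0 (inj_eq (addrI a)) eq_sym scaler_eq0 negb_or c0.
    by rewrite subr_eq0.
  have r'l : ~ on_line a b r'.
    move=> abr'; apply: rl; apply: (on_line_change (a := a) (b := r')) => //.
    - exact: on_linel.
    - exact: (on_line_change r'a (on_linel a b)) abr' (on_liner a b).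
    - exact: (on_line_change r'a (on_linel a r)) arr' (on_liner a r).
  have [rG rG'] := (out _ rC rl, out _ rC' r'l).
  have far : f a != f r by apply: fneq => //; rewrite eq_sym.
  have frr' : f r != f r' by apply: fneq.
  have rr'a : on_line r r' a by apply: on_line_change rneq (on_liner a r) arr' (on_linel a r).
  have frb : on_line (f a) (f r) (f b).
    by apply: (on_line_change far (on_linel (f a) (f b)) _ (on_liner (f a) (f b))); rewrite -ry.
  have frr'a := fG rG rG' rneq rr'a.
  have farr' : on_line (f a) (f r) (f r').
    exact: on_line_change far frr'a (on_linel _ _) (on_liner _ _).
  have fbr : on_line (f r) (f r') (f b).
    exact: on_line_change frr' (on_liner _ _) farr' frb.
  (* As [f b] lies on the image of the line through [r] and [r'], injectivity puts [b] on that line,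
     which also contains [a]: so [r] is on the line through [a] and [b] after all. *)
  have [z rr'z zE] := on_line_surj rC rC' rneq (fun x => @fG _ _ x rG rG' rneq) fbr.
  case: rl; apply: (on_line_change (a := r) (b := r') ab rr'a); last exact: on_linel.
  by rewrite (finj bC _ zE) // (mem_on_line rC rC' rr'z).
(* [g] sends a parameter on the image line to that of a preimage; being injective on a finite field,
   it is bijective. *)
have /fin_all_exists[g gE] (m : F) :=
  inL (f a + m *: (f b - f a)) (ex_intro _ m erefl).
have ginj : injective g.
  move=> c d cd; have : c *: (f b - f a) = d *: (f b - f a).
    by apply: (addrI (f a)); rewrite !gE cd.
  move/eqP; rewrite -subr_eq0 -scalerBl scaler_eq0 !subr_eq0.
  by rewrite [f b == f a]eq_sym (negPf (fneq _ _ aC bC ab)) orbF => /eqP.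
have [h gh hg] := injF_bij ginj.
by case: abx => c ->; exists (h c); rewrite gE hg.
Qed.

Hypothesis dim2 : forall u, u \in C -> exists2 w, w \in C & forall c : F, w != c *: u.
Hypothesis f0 : f 0 = 0.

(** The point [u + v] is on a line joining a multiple of [u] to a multiple of [v], so [f (u + v)] is
    a combination of [f u] and [f v]; it remains to see that both coefficients are 1. *)
Lemma additive_indep u v : u \in C -> v \in C -> (forall c : F, v != c *: u) ->
  (forall c : F, u != c *: v) -> f (u + v) = f u + f v.
Proof.
move=> uC vC vu uv.
have [c c0 c1] := exists_not01 q2.
have c1' : 1 - c != 0 by rewrite subr_eq0 eq_sym.
have u0 : u != 0 by rewrite -(scale0r v).
have v0 : v != 0 by rewrite -(scale0r u).
have on0 w d : w \in C -> w != 0 -> exists e : F, f (d *: w) = e *: f w.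
  move=> wC w0; have [||||e] := @on_line_all 0 w (d *: w); rewrite ?f0 //.
  - by rewrite eq_sym.
  - by exists d; rewrite subr0 add0r.
  by rewrite subr0 add0r => ->; exists e.
have on0s w d : w \in C -> w != 0 -> exists e : F, d *: f w = f (e *: w).
  move=> wC w0; have [|||x [e ->] E] := @on_line_surj 0 w (d *: f w) C0 wC.
  - by rewrite eq_sym.
  - by move=> x; apply: on_line_all => //; rewrite eq_sym.
  - by exists d; rewrite f0 subr0 add0r.
  by exists e; rewrite E subr0 add0r.
have [a [b E]] : exists a b : F, f (u + v) = a *: f u + b *: f v.
  have [e Ee] := on0 u c^-1 uC u0; have [e' Ee'] := on0 v (1 - c)^-1 vC v0.
  have [||||d] := @on_line_all ((1 - c)^-1 *: v) (c^-1 *: u) (u + v); rewrite ?CZ //.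
  - apply: contra_neq (uv (c * (1 - c)^-1)) => /(congr1 ( *:%R c)).
    by rewrite !scalerA mulfV // scale1r.
  - by exists c; rewrite affine_combE !scalerA !mulfV // !scale1r addrC.
  rewrite affine_combE Ee Ee' !scalerA => ->.
  by exists (d * e), ((1 - d) * e'); rewrite [LHS]addrC.
have uvC : u + v \in C by rewrite CD.
(* The line through [w] with direction [z] misses the multiples of [z]. For [a'] other than 1, its
   image contains a multiple of [f z], which is the image of a multiple of [z]. *)
have key w z a' b' : w \in C -> z \in C -> z != 0 -> (forall k : F, w != k *: z) ->
    f (w + z) = a' *: f w + b' *: f z -> a' = 1.
  move=> wC zC z0 wz Ez; apply/eqP; apply: contraT => a1.
  have a1' : 1 - a' != 0 by rewrite subr_eq0 eq_sym.
  have [k Ek] := on0s z ((1 - a')^-1 * b') zC z0.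
  have wwz : w != w + z by rewrite -subr_eq0 opprD addrA subrr sub0r oppr_eq0.
  have [||y [l ->] Ey] := @on_line_surj w (w + z) (f (k *: z)) wC (CD wC zC) wwz.
  - by move=> x; apply: on_line_all => //; apply: CD.
  - exists (1 - a')^-1; rewrite Ez affine_combE scalerDr !scalerA addrA -scalerDl.
    rewrite -Ek [X in X *: f w](_ : _ = 0) ?scale0r ?add0r //.
    by apply: (mulfI a1'); rewrite mulrDr mulrBr mulr1 mulrA mulfV // mul1r mulr0; ring.
  move: Ey; rewrite [w + z]addrC addrK => /finj.
  rewrite !(CZ, CD) // => /(_ isT isT) Ey; case/negP: (wz (k - l)).
  by rewrite scalerBl Ey addrK.
have a1 : a = 1 by apply: (key u v _ b).
have b1 : b = 1 by apply: (key v u _ a); rewrite // addrC E addrC.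
by rewrite E a1 b1 !scale1r.
Qed.

(** For dependent [u] and [v = c u], take [w] independent of [u] and split [f (u + c u + w)] in two
    ways. *)
Lemma line_preserving_additive u v : u \in C -> v \in C -> f (u + v) = f u + f v.
Proof.
move=> uC vC.
have [->|u0] := eqVneq u 0; first by rewrite f0 !add0r.
have [->|v0] := eqVneq v 0; first by rewrite f0 !addr0.
have indep w x : x \in C -> x != 0 -> w \in C -> (forall c : F, w != c *: x) ->
    forall d : F, f (d *: x + w) = f (d *: x) + f w.
  move=> xC x0 wC wx d; have [->|d0] := eqVneq d 0; first by rewrite scale0r f0 !add0r.
  have dx c : w != c *: (d *: x) by rewrite scalerA.
  apply: additive_indep => // [|c]; first exact: CZ.
  have [->|c0] := eqVneq c 0; first by rewrite scale0r scaler_eq0 negb_or d0.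
  by apply: contra_neq (dx c^-1) => ->; rewrite scalerA mulVf // scale1r.
have [/existsP[c /eqP vE]|/existsPn vu] := boolP [exists c : F, v == c *: u]; last first.
  by have := indep v u uC u0 vC vu 1; rewrite scale1r.
have [w wC wu] := dim2 uC.
have wcu d : w + c *: u != d *: u.
  by apply: contra_neq (wu (d - c)) => E; rewrite scalerBl -E addrK.
have E1 := indep w u uC u0 wC wu (1 + c).
have E2 := indep (w + c *: u) u uC u0 (CD wC (CZ _ uC)) wcu 1.
have E3 := indep w u uC u0 wC wu c.
rewrite scalerDl scale1r in E1; rewrite scale1r in E2.
apply: (addIr (f w)); rewrite vE -E1 -[RHS]addrA -E3.
by rewrite -addrA [c *: u + w]addrC E2.
Qed.

End LinePreserving.

(** * Coordinates of a pseudo-hyperoval *)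

Lemma mulmx_row_inj (F : fieldType) m p (A B : 'M[F]_(m, p)) :
  (forall x : 'rV_m, x *m A = x *m B) -> A = B.
Proof. by move=> AB; apply/row_matrixP => i; rewrite !rowE AB. Qed.

Section Slopes.

Variables (F : finFieldType) (n k : nat).
Variable pi : 'I_k -> {vspace 'rV[F]_(3 * n.+1)}.
Hypotheses (k2 : (2 < k)%N) (arc : is_generalized_arc pi).
Variables (i j l : 'I_k) (P Q : 'M[F]_(n.+1, 3 * n.+1)).
Hypotheses (ijl : uniq [:: i; j; l]) (PE : pi j = rowvs P) (QE : pi l = rowvs Q).

Let ij : i != j. Proof. by move: ijl; rewrite /= !inE negb_or => /andP[/andP[]]. Qed.
Let il : i != l. Proof. by move: ijl; rewrite /= !inE negb_or => /andP[/andP[]]. Qed.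
Let jl : j != l. Proof. by move: ijl; rewrite /= !inE => /and3P[]. Qed.

Lemma frame_mod0 (x y : 'rV_n.+1) : x *m P + y *m Q \in pi i -> x = 0 /\ y = 0.
Proof.
have [R RE] := rowvs_dim (arc_dim arc i); rewrite RE => /mem_rowvsP[z zE].
have [|] := arc_indep3 arc ijl RE PE QE (x := - z) (y := x) (z := y); last by [].
by rewrite -addrA zE mulNmx addNr.
Qed.

Lemma frame_mod (a b c d : 'M_n.+1) (x : 'rV_n.+1) :
  (pi i + rowvs (a *m P + b *m Q) <= pi i + rowvs (c *m P + d *m Q))%VS ->
  exists y : 'rV_n.+1, x *m a = y *m c /\ x *m b = y *m d.
Proof.
move/subvP/(_ (x *m (a *m P + b *m Q))).
rewrite (subvP (addvSr _ _)) ?rowvs_mul // => /(_ isT).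
case/memv_addP=> p pi_p [_ /mem_rowvsP[y ->] E]; exists y.
have [|/eqP + /eqP] := @frame_mod0 (x *m a - y *m c) (x *m b - y *m d).
  rewrite !mulmxBl addrACA -opprD -!mulmxA -!mulmxDr E addrK //.
by rewrite !subr_eq0 => /eqP -> /eqP ->.
Qed.

Lemma frame_inj (a b : 'M_n.+1) :
  (pi i + rowvs (P + a *m Q) = pi i + rowvs (P + b *m Q))%VS -> a = b.
Proof.
move=> E; apply: mulmx_row_inj => x.
have [|y] := @frame_mod 1%:M a 1%:M b x; first by rewrite mul1mx E.
by rewrite !mulmx1 => -[-> ->].
Qed.

Lemma frame_notl (a : 'M_n.+1) : (pi i + rowvs (P + a *m Q) <> pi i + pi l)%VS.
Proof.
move=> E; have [|y] := @frame_mod 1%:M a 0 1%:M (const_mx 1).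
  by rewrite !mul1mx mul0mx add0r E QE.
by rewrite mulmx1 mulmx0 => -[/rowP/(_ 0)/eqP]; rewrite !mxE oner_eq0.
Qed.

Variable c : 'I_k -> 'M[F]_n.+1.
Hypothesis cE : forall m, m != i -> m != l -> (pi i + pi m = pi i + rowvs (P + c m *m Q))%VS.

(** Modulo [pi i], the element [pi m] is the graph of [c m] in the frame [P], [Q]; here [pi j] has
    slope 0 and [pi l] is the slope infinity. *)
Definition slopes : {pred 'M[F]_n.+1} := [pred x | [exists m, [&& m != i, m != l & x == c m]]].

Lemma slopesP x : reflect (exists m, [/\ m != i, m != l & x = c m]) (x \in slopes).
Proof.
apply: (iffP existsP) => -[m]; first by case/and3P=> mi ml /eqP ->; exists m.
by case=> mi ml ->; exists m; rewrite mi ml eqxx.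
Qed.

Lemma slope_base : c j = 0.
Proof.
apply: frame_inj; rewrite -cE 1?eq_sym //; last by rewrite eq_sym.
by rewrite mul0mx addr0 PE.
Qed.

(** A kernel vector [x] puts [x (P + c m Q)] into both [pi i + pi m] and [pi i + pi m'], which by
    the arc condition meet only in [pi i]; then [x = 0]. *)
Lemma slope_diff m m' : m != i -> m' != i -> m != l -> m' != l -> m != m' ->
  c m - c m' \in unitmx.
Proof.
move=> mi mi' ml ml' mm'; rewrite -row_free_unit; apply: inj_row_free => x.
rewrite mulmxBr => /eqP; rewrite subr_eq0 => /eqP xcc.
have [M ME] := rowvs_dim (arc_dim arc m); have [M' ME'] := rowvs_dim (arc_dim arc m').
have [R RE] := rowvs_dim (arc_dim arc i).
have imm : uniq [:: i; m; m'] by rewrite /= !inE negb_or eq_sym mi eq_sym mi' mm'.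
have : x *m (P + c m *m Q) \in (pi i + pi m)%VS.
  by rewrite cE // (subvP (addvSr _ _)) ?rowvs_mul.
have : x *m (P + c m *m Q) \in (pi i + pi m')%VS.
  by rewrite cE // (subvP (addvSr _ _)) // mulmxDr mulmxA xcc -mulmxA -mulmxDr rowvs_mul.
rewrite ME ME' {1 2}RE => /memv_addP[_ /mem_rowvsP[p' ->] [_ /mem_rowvsP[z ->] E']].
move=> /memv_addP[_ /mem_rowvsP[p ->] [_ /mem_rowvsP[y ->] E]].
have [|_ y0 _] := arc_indep3 arc imm RE ME ME' (x := p - p') (y := y) (z := - z).
  have -> : (p - p') *m R + y *m M + (- z) *m M' = (p *m R + y *m M) - (p' *m R + z *m M').
    by rewrite mulmxBl mulNmx opprD addrACA [RHS]addrA.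
  by rewrite -E -E' subrr.
have [] := @frame_mod0 x (x *m c m); last by [].
by rewrite -mulmxA -mulmxDr E y0 mul0mx addr0 RE rowvs_mul.
Qed.

Lemma slopes_inj : {in [pred m | (m != i) && (m != l)] &, injective c}.
Proof.
move=> m m' /andP[mi ml] /andP[mi' ml']; apply: contra_eq => mm'.
have := slope_diff mi mi' ml ml' mm'; apply: contraTneq => ->.
by rewrite subrr -[_ \in _]/(0 \is a GRing.unit) unitr0.
Qed.

Variable W : {vspace 'rV[F]_(3 * n.+1)}.
Hypotheses (dW : \dim W = (2 * n.+1)%N) (Wpi : (W :&: pi i = 0)%VS).

Lemma slopes_regset : is_regular_spread n.+1 W (Delta pi i W) -> regset slopes.
Proof.
move=> reg; have ji : j != i by rewrite eq_sym.
have li : l != i by rewrite eq_sym.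
split.
- by apply/slopesP; exists j; rewrite slope_base.
- move=> _ _ e /slopesP[m [mi ml ->]] /slopesP[m' [mi' ml' ->]].
  have [->|mm'] := eqVneq m m'.
    by rewrite subrr scaler0 addr0; apply/slopesP; exists m'.
  (* The second generator is scaled so that the slopes [c m], infinity and [c m'] belong to [P], [Q]
     and [P + Q] of the pencil. *)
  have u : c m' - c m \in unitmx by rewrite slope_diff // eq_sym.
  have [||||m2 m2i] := regular_pencil (isT : (0 < n.+1)%N) k2 arc dW Wpi e reg mi li mi' _
      (P := P + c m *m Q) (Q := (c m' - c m) *m Q).
  + by rewrite /= !inE negb_or mm' ml eq_sym ml'.
  + by rewrite cE.
  + by rewrite rowvs_unit // QE.
  + by rewrite mulmxBl -addrA [c m *m Q + _]addrC subrK cE.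
  rewrite scalemxAl -addrA -mulmxDl => E.
  have m2l : m2 != l by apply/eqP => m2l; rewrite m2l in E; exact: frame_notl E.
  by apply/slopesP; exists m2; split=> //; apply: frame_inj; rewrite E cE.
- move=> _ _ /slopesP[m [mi ml ->]] /slopesP[m' [mi' ml' ->]] cc.
  by apply: slope_diff => //; apply: contra_neq cc => ->.
- move=> _ _ e /slopesP[m [mi ml ->]] /slopesP[m' [mi' ml' ->]] c0 c0' M M0.
  have unit_c m1 : m1 != i -> m1 != l -> c m1 != 0 -> c m1 \in unitmx.
    move=> i1 l1 c1; rewrite -[c m1]subr0 -slope_base slope_diff //.
    by apply: contra_neq c1 => ->; exact: slope_base.
  have u := unit_c _ mi ml c0; have u' := unit_c _ mi' ml' c0'.
  have [mm'|mm'] := eqVneq m m'.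
    rewrite /M mm' subrr scaler0 addr0 unitrV invrK; split=> //.
    by apply/slopesP; exists m'.
  have mj : m != j by apply: contra_neq c0 => ->; exact: slope_base.
  have mj' : m' != j by apply: contra_neq c0' => ->; exact: slope_base.
  (* The regulus through the slopes [c m], 0 and [c m'] is written in inverse coordinates [x P + Q],
     where the slope 0 is at infinity. *)
  have ud : (c m')^-1 - (c m)^-1 \in unitmx.
    have -> : (c m')^-1 - (c m)^-1 = (c m')^-1 *m (c m - c m') *m (c m)^-1.
      by rewrite mulmxBr mulmxBl mulVmx // mul1mx mulmxK.
    by rewrite !unitmx_mul !unitmx_inv u u' slope_diff.
  have vs_inv m1 : c m1 \in unitmx -> rowvs ((c m1)^-1 *m P + Q) = rowvs (P + c m1 *m Q).
    move=> u1; rewrite -(rowvs_unit (P + _) (_ : invmx (c m1) \in unitmx)) ?unitmx_inv //.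
    by rewrite mulmxDr mulKmx.
  have [||||m2 m2i] := regular_pencil (isT : (0 < n.+1)%N) k2 arc dW Wpi e reg mi ji mi' _
      (P := (c m)^-1 *m P + Q) (Q := ((c m')^-1 - (c m)^-1) *m P).
  + by rewrite /= !inE negb_or mm' mj eq_sym mj'.
  + by rewrite vs_inv // cE.
  + by rewrite rowvs_unit // PE.
  + by rewrite mulmxBl addrC subrKA vs_inv // cE.
  rewrite scalemxAl addrAC -mulmxDl -/M => E.
  have [m2l|m2l] := eqVneq m2 l.
    case/eqP: M0; apply: mulmx_row_inj => x.
    have [|y] := @frame_mod M 1%:M 0 1%:M x; last by case; rewrite mulmx0 mulmx0.
    by rewrite !mul1mx mul0mx add0r E m2l QE.
  have Mc : M *m c m2 = 1%:M.
    apply: mulmx_row_inj => x.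
    have [|y] := @frame_mod M 1%:M 1%:M (c m2) x.
      by rewrite !mul1mx E cE.
    by rewrite !mulmx1 mulmxA => -[-> ->].
  have [uM uc] := mulmx1_unit Mc; split; first exact: uM.
  have -> : M^-1 = c m2.
    by rewrite -[M^-1]mulr1 -[1]/(1%:M) -Mc -[M *m _]/(M * _) mulKr.
  by apply/slopesP; exists m2.
Qed.

End Slopes.

Lemma addr_telescope (V : zmodType) (p x x' y y' : V) :
  x - x' + (y - y') + (p + x' + y') = p + x + y.
Proof.
by rewrite addrC addrACA [y' + _]addrC subrK -[p + x' + _]addrA [x' + _]addrC subrK.
Qed.

Lemma addv_absorb (F : fieldType) N m (U : {vspace 'rV[F]_N}) (M M' : 'M[F]_(m, N)) :
  (forall x : 'rV_m, x *m (M - M') \in U) -> (U + rowvs M = U + rowvs M')%VS.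
Proof.
have sub (A B : 'M[F]_(m, N)) : (forall x : 'rV_m, x *m (A - B) \in U) ->
    (U + rowvs A <= U + rowvs B)%VS.
  move=> AB; rewrite subv_add addvSl; apply/subvP => _ /mem_rowvsP[x ->].
  by rewrite -[A](subrK B) mulmxDr memv_add ?rowvs_mul.
move=> MM; apply/eqP; rewrite eqEsubv !sub // => x.
by rewrite -opprB mulmxN memvN.
Qed.

(* [pi m] is the point [(p1(t) : p2(t) : p3(t))] of the plane over the field [F[t]]. *)
Definition field_coords (F : finFieldType) n k (pi : 'I_k -> {vspace 'rV[F]_(3 * n.+1)}) :=
  exists t : 'M[F]_n.+1, exists T1 T2 T3 : 'M[F]_(n.+1, 3 * n.+1),
  [/\ irreducible_poly (mxminpoly t), degree_mxminpoly t = n.+1,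
      (rowvs T1 + rowvs T2 + rowvs T3 = fullv)%VS
    & forall m, exists p1 p2 p3, pi m =
        rowvs (horner_mx t p1 *m T1 + horner_mx t p2 *m T2 + horner_mx t p3 *m T3)].

(** * Affine coordinates with two elements at infinity *)

Section Coordinates.

Variables (F : finFieldType) (n : nat).
Hypotheses (pn : prime n.+1) (q2 : (2 < #|F|)%N).
Local Notation k := (#|F| ^ n.+1 + 2)%N.
Variable pi : 'I_k -> {vspace 'rV[F]_(3 * n.+1)}.
Hypothesis arc : is_generalized_arc pi.
Variables (e1 e2 i0 : 'I_k) (Q1 Q2 P0 : 'M[F]_(n.+1, 3 * n.+1)).
Hypotheses (u012 : uniq [:: e1; e2; i0]) (E1 : pi e1 = rowvs Q1) (E2 : pi e2 = rowvs Q2).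
Hypothesis E0 : pi i0 = rowvs P0.

Let k2 : (2 < k)%N. Proof. by rewrite addn2 !ltnS expn_gt0 (ltnW (ltnW q2)). Qed.

Definition finite_index m := (m != e1) && (m != e2).

Lemma finite_i0 : finite_index i0.
Proof.
move: u012; rewrite /= !inE negb_or /finite_index => /and3P[/andP[_ e10] e20 _].
by rewrite eq_sym e10 eq_sym e20.
Qed.

Let e12 : e1 != e2.
Proof. by move: u012; rewrite /= !inE negb_or => /and3P[/andP[]]. Qed.

(** The coefficient matrix of [P0] is invertible because [pi m] is skew to [pi e1 + pi e2], so it
    can be normalised to 1. *)
Lemma affine_coord m : finite_index m ->
  exists ab : 'M[F]_n.+1 * 'M[F]_n.+1, pi m = rowvs (P0 + ab.1 *m Q1 + ab.2 *m Q2).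
Proof.
move=> /andP[m1 m2]; have [M ME] := rowvs_dim (arc_dim arc m).
have full : (rowvs Q1 + rowvs Q2 + rowvs P0 = fullv)%VS.
  by case: arc => _ _ /(_ _ _ _ u012); rewrite E1 E2 E0.
have : (M <= col_mx (col_mx Q1 Q2) P0)%MS by rewrite -rowvs_sub !rowvs_col full subvf.
case/submxP=> D; rewrite -[D]hsubmxK -[lsubmx D]hsubmxK !mul_row_col.
set X := lsubmx _; set Y := rsubmx _; set Z := rsubmx _ => MX.
have uZ : Z \in unitmx.
  rewrite -row_free_unit; apply: inj_row_free => x xZ.
  have u : uniq [:: e1; e2; m] by rewrite /= !inE negb_or e12 eq_sym m1 eq_sym m2.
  have [|] := arc_indep3 arc u E1 E2 ME (x := - (x *m X)) (y := - (x *m Y)) (z := x); last by [].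
  rewrite MX !mulmxDr [x *m (Z *m P0)]mulmxA xZ mul0mx addr0 !mulmxA !mulNmx -opprD.
  by rewrite addNr.
exists (invmx Z *m X, invmx Z *m Y); rewrite ME /=.
rewrite -(rowvs_unit M (_ : invmx Z \in unitmx)) ?unitmx_inv // MX !mulmxDr !mulmxA.
by rewrite mulVmx // mul1mx addrC addrA.
Qed.

Variables a b : 'I_k -> 'M[F]_n.+1.
Hypothesis ab : forall m, finite_index m -> pi m = rowvs (P0 + a m *m Q1 + b m *m Q2).

Let u201 : uniq [:: e2; i0; e1].
Proof. by move: u012; rewrite -(rot_uniq 1). Qed.
Let u102 : uniq [:: e1; i0; e2].
Proof.
move: u012; rewrite /= !inE !negb_or => /and3P[/andP[n12 n10] n20 _].
by rewrite n10 n12 eq_sym n20.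
Qed.

Lemma aE m : m != e2 -> m != e1 -> (pi e2 + pi m = pi e2 + rowvs (P0 + a m *m Q1))%VS.
Proof.
have fm' : m != e1 -> m != e2 -> finite_index m by rewrite /finite_index => -> ->.
move=> m2 m1; rewrite (ab (fm' m1 m2)); apply: addv_absorb => x.
by rewrite addrAC subrr add0r mulmxA E2 rowvs_mul.
Qed.

Lemma bE m : m != e1 -> m != e2 -> (pi e1 + pi m = pi e1 + rowvs (P0 + b m *m Q2))%VS.
Proof.
have fm' : m != e1 -> m != e2 -> finite_index m by rewrite /finite_index => -> ->.
move=> m1 m2; rewrite (ab (fm' m1 m2)); apply: addv_absorb => x.
by rewrite [_ + b m *m Q2]addrAC [_ - (_ + _)]addrAC subrr add0r mulmxA E1 rowvs_mul.
Qed.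

(** Modulo [pi e2] only the coordinate [a] survives, modulo [pi e1] only [b]: these are the slope
    sets at the two points at infinity. *)
Definition Ca := slopes e2 e1 a.
Definition Cb := slopes e1 e2 b.

Lemma CaP x : reflect (exists2 m, finite_index m & x = a m) (x \in Ca).
Proof.
apply: (iffP (slopesP _ _ _ _)) => [[m [m2 m1 ->]]|[m /andP[m1 m2] ->]]; exists m => //.
by rewrite /finite_index m1.
Qed.

Lemma CbP x : reflect (exists2 m, finite_index m & x = b m) (x \in Cb).
Proof.
apply: (iffP (slopesP _ _ _ _)) => [[m [m2 m1 ->]]|[m /andP[m1 m2] ->]]; exists m => //.
by rewrite /finite_index m1 m2.
Qed.

Lemma a_unit m m' : finite_index m -> finite_index m' -> m != m' -> a m - a m' \in unitmx.
Proof. by case/andP=> ? ? /andP[? ?]; apply: (slope_diff arc u201 E0 E1 aE). Qed.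

Lemma b_unit m m' : finite_index m -> finite_index m' -> m != m' -> b m - b m' \in unitmx.
Proof. by case/andP=> ? ? /andP[? ?]; apply: (slope_diff arc u102 E0 E2 bE). Qed.

Lemma a_inj : {in finite_index &, injective a}.
Proof.
move=> m m' /andP[? ?] /andP[? ?]; apply: (slopes_inj arc u201 E0 E1 aE); exact/andP.
Qed.

Lemma b_inj : {in finite_index &, injective b}.
Proof.
move=> m m' /andP[? ?] /andP[? ?]; apply: (slopes_inj arc u102 E0 E2 bE); exact/andP.
Qed.

Lemma a_base : a i0 = 0. Proof. exact: (slope_base arc u201 E0 E1 aE). Qed.
Lemma b_base : b i0 = 0. Proof. exact: (slope_base arc u102 E0 E2 bE). Qed.

(** The slope of the line joining two affine points. Lines to [e1] get slope 0 and those to [e2] the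
    slope infinity. *)
Definition slope i m := if m == e1 then 0 else (a m - a i)^-1 * (b m - b i).
Definition slope_set i := slopes i e2 (slope i).

Lemma slopeE i m : finite_index i -> m != i -> m != e2 ->
  (pi i + pi m = pi i + rowvs (Q1 + slope i m *m Q2))%VS.
Proof.
move=> fi mi m2; rewrite /slope; case: eqP => [->|/eqP m1].
  by rewrite mul0mx addr0 E1.
have fm : finite_index m by rewrite /finite_index m1.
have u := a_unit fm fi mi.
rewrite -(rowvs_unit (Q1 + _) u) (ab fm); apply: addv_absorb => x.
have -> : P0 + a m *m Q1 + b m *m Q2 -
    (a m - a i) *m (Q1 + (a m - a i)^-1 * (b m - b i) *m Q2) = P0 + a i *m Q1 + b i *m Q2.
  rewrite mulmxDr mulmxA [_ *m ((a m - a i)^-1 * _)](mulVKr u) !mulmxBl !opprD !opprK.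
  rewrite -!addrA; congr (_ + _).
  rewrite [b m *m Q2 + _]addrC !addrA addrN add0r -!addrA; congr (_ + _).
  by rewrite addrCA addNr addr0.
by rewrite (ab fi) rowvs_mul.
Qed.

Let u_i12 i : finite_index i -> uniq [:: i; e1; e2].
Proof. by case/andP=> i1 i2; rewrite /= !inE negb_or i1 i2 e12. Qed.

Lemma slope_in i m : finite_index i -> m != i -> m != e2 -> slope i m \in slope_set i.
Proof. by move=> fi mi m2; apply/slopesP; exists m. Qed.

Lemma slopeC i j : slope i j = slope j i \/ (i == e1) || (j == e1).
Proof.
rewrite /slope; case: (i == e1); first by right; rewrite ?orbT.
case: (j == e1); first by right.
left; rewrite -(opprB (a i)) -(opprB (b i)) invrN mulNr mulrN opprK //.
Qed.

Lemma slope_mul i m : finite_index i -> finite_index m -> m != i ->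
  (a m - a i) * slope i m = b m - b i.
Proof.
move=> fi fm mi; rewrite /slope; case/andP: (fm) => /negPf -> _.
by rewrite mulVKr // [_ \is a _](a_unit fm fi mi).
Qed.

Lemma slope_sym i j : finite_index i -> finite_index j -> slope i j = slope j i.
Proof. by move=> /andP[/negPf i1 _] /andP[/negPf j1 _]; case: (slopeC i j); rewrite ?i1 ?j1. Qed.

Lemma slope_unit i m : finite_index i -> finite_index m -> m != i ->
  slope i m \is a GRing.unit.
Proof.
move=> fi fm mi; rewrite /slope; case/andP: (fm) => /negPf -> _.
rewrite unitrMl ?unitrV; first exact: (a_unit fm fi mi).
exact: (b_unit fm fi mi).
Qed.

Lemma slope_inj i : finite_index i -> {in [pred m | (m != i) && (m != e2)] &, injective (slope i)}.
Proof. by move=> fi; apply: (slopes_inj arc (u_i12 fi) E1 E2) => m; apply: slopeE. Qed.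

Lemma card_finite : #|finite_index| = (#|F| ^ n.+1)%N.
Proof.
have -> : #|finite_index| = #|~: [set e1; e2]|.
  by apply: eq_card => m; rewrite !inE negb_or.
by rewrite cardsCs setCK card_ord cards2 e12 addnK.
Qed.

Lemma not_all_multiples (C : {pred 'M[F]_n.+1}) (u : 'M[F]_n.+1) :
  (#|F| < #|C|)%N -> exists2 w, w \in C & forall c : F, w != c *: u.
Proof.
move=> FC; have : ~~ (C \subset [set c *: u | c in F]).
  apply: contraTN FC => /subset_leq_card; rewrite -leqNgt => /leq_trans; apply.
  exact: leq_imset_card.
case/subsetPn=> w wC wu; exists w => // c; apply: contraNneq wu => ->.
exact: imset_f.
Qed.

Lemma lt_card_pow : (#|F| < #|F| ^ n.+1)%N.
Proof. by have := ltn_exp2l 1 n.+1 (ltnW q2); rewrite expn1 => ->; apply: prime_gt1. Qed.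

Lemma card_slope_set i : finite_index i -> (#|F| < #|slope_set i|)%N.
Proof.
move=> fi; have := card_in_imset (slope_inj fi).
have -> : #|[pred m | (m != i) && (m != e2)]| = (#|F| ^ n.+1)%N.
  have -> : #|[pred m | (m != i) && (m != e2)]| = #|~: [set i; e2]|.
    by apply: eq_card => m; rewrite !inE negb_or.
  by rewrite cardsCs setCK card_ord cards2; case/andP: fi => _ ->; rewrite addnK.
move=> cS; apply: leq_trans lt_card_pow _; rewrite -cS; apply/subset_leq_card/subsetP => x.
by case/imsetP=> m /andP[mi m2] ->; apply: slope_in.
Qed.

Lemma card_Ca : (#|F| < #|Ca|)%N.
Proof.
have cS := card_in_imset a_inj; rewrite card_finite in cS.
apply: leq_trans lt_card_pow _; rewrite -cS; apply/subset_leq_card/subsetP => x.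
by case/imsetP=> m fm ->; apply/CaP; exists m.
Qed.

(** The differences of [b] along the sides of the triangle [i], [j], [m] add up, which links the
    slopes of the three sides linearly. *)
Lemma slope_eq i j m : finite_index i -> finite_index j -> finite_index m ->
  m != i -> m != j -> i != j ->
  (a m - a i) * (slope i m - slope j m) = (a j - a i) * (slope i j - slope j m).
Proof.
move=> fi fj fm mi mj ij; rewrite !mulrBr !slope_mul // 1?eq_sym //.
have -> : a m - a i = (a m - a j) + (a j - a i) by rewrite addrA subrK.
rewrite mulrDl slope_mul // opprD addrA; congr (_ - _).
by rewrite opprB addrC addrA subrK.
Qed.

(* With a common slope set [s K], [K] a field, the relation [slope_eq] solves
   for the coordinates of every point inside [K]. *)
Lemma equal_slopes_coords i j : finite_index i -> finite_index j -> i != j ->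
  regset (slope_set i) -> slope_set i =i slope_set j -> field_coords pi.
Proof.
move=> fi fj ij rS Sij; have ji : j != i by rewrite eq_sym.
have [c0 c00 c01] := exists_not01 q2.
pose s := slope i j; pose al := a j - a i; pose be := b j - b i.
have sS : s \in slope_set i by apply: slope_in => //; case/andP: fj.
have us : s \is a GRing.unit by apply: slope_unit.
have s0 : s != 0 by apply: contraTneq us => ->; rewrite unitr0.
have ual : al \is a GRing.unit by apply: a_unit.
have ube : be \is a GRing.unit by apply: b_unit.
have alsE : al * s = be by apply: slope_mul.
pose K := [pred x | s * x \in slope_set i].
have rK : regset K := regset_shift rS sS s0.
have K1 : 1 \in K by rewrite inE mulr1.
(* A slope not proportional to [s] makes [t] non-scalar, so that [K] is the field [F[t]]. *)
have [w wS ws] := not_all_multiples s (card_slope_set fi).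
pose t := s^-1 * w.
have tK : t \in K by rewrite inE mulVKr.
have nst : ~~ is_scalar_mx t.
  apply/negP => /is_scalar_mxP[c tc]; case/negP: (ws c).
  by rewrite -[w](mulVKr us) -/t tc -[s * _]/(s *m _) mul_mx_scalar.
have KP x : x \in K -> exists p, x = horner_mx t p by apply: regset_gen.
(* In this frame [e1], [e2], [i], [j] become (1:0:0), (0:1:0), (0:0:1), (1:1:1). *)
exists t, (s^-1 *m Q1), Q2, (be^-1 *m (P0 + a i *m Q1 + b i *m Q2)); split.
- by apply: mxminpoly_irreducible; apply: (regset_horner_unit q2 rK K1 tK).
- exact: (regset_degree pn q2 rK K1 tK nst).
- rewrite !rowvs_unit ?unitmx_inv // -(ab fi) -E1 -E2.
  case: arc => _ _; apply; case/andP: fi => i1 i2.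
  by rewrite /= !inE negb_or e12 eq_sym i1 eq_sym i2.
move=> m; have [->|m1] := eqVneq m e1.
  exists 1, 0, 0; rewrite rmorph1 !rmorph0 !mul0mx !addr0 mul1mx rowvs_unit ?unitmx_inv //.
have [->|m2] := eqVneq m e2.
  by exists 0, 1, 0; rewrite rmorph1 !rmorph0 !mul0mx addr0 add0r mul1mx.
have fm : finite_index m by rewrite /finite_index m1.
suff [x [y [xK yK ux uy]]] : exists x y, [/\ exists p, x = horner_mx t p,
    exists p, y = horner_mx t p, be * (x * s^-1) = a m - a i & be * y = b m - b i].
  case: xK => p xp; case: yK => r yr; exists p, r, 1; rewrite -xp -yr rmorph1 mul1mx.
  rewrite (ab fm) -[RHS](rowvs_unit _ (ube : be \in unitmx)); congr rowvs.
  rewrite !mulmxDr !mulmxA [be *m be^-1]mulmxV // !mul1mx.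
  rewrite -[be *m x]/(be * x) -[be * x *m s^-1]/(be * x * s^-1) -mulrA ux.
  rewrite -[be *m y]/(be * y) uy !mulmxBl.
  by rewrite addr_telescope.
have [->|mi] := eqVneq m i.
  by exists 0, 0; split; try (by exists 0; rewrite rmorph0); rewrite ?mul0r mulr0 subrr.
have [->|mj] := eqVneq m j.
  exists 1, 1; split; try (by exists 1; rewrite rmorph1); rewrite ?mulr1 //.
  by rewrite mul1r -alsE mulrK.
have sim : slope i m \in slope_set i by apply: slope_in.
have sjm : slope j m \in slope_set i by rewrite Sij; apply: slope_in.
have key := slope_eq fi fj fm mi mj ij.
(* If both slopes of [m] agreed, [slope_eq] would make them equal to [s], and [m] would be [j]. *)
have cd0 : slope i m - slope j m != 0.
  apply: contraNneq mj => cd; move: key; rewrite cd mulr0 => /esym/eqP.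
  rewrite -(mulr0 al) (inj_eq (mulrI ual)) subr_eq0 => /eqP sd.
  move/eqP: cd; rewrite subr_eq0 -sd => /eqP/slope_inj -> //; rewrite inE ?mi ?ji //.
  by case/andP: fj.
have k1K : s^-1 * (s - slope j m) \in K by rewrite inE mulVKr // (regsetB c00 c01 rS).
have k2K : s^-1 * (slope i m - slope j m) \in K by rewrite inE mulVKr // (regsetB c00 c01 rS).
have ucd : slope i m - slope j m \is a GRing.unit.
  by apply: (regset_unit rS) => //; rewrite (regsetB c00 c01 rS).
have k20 : s^-1 * (slope i m - slope j m) != 0.
  apply: contra_neq cd0 => E; by rewrite -[_ - _](mulVKr us) E mulr0.
have [p1 P1] := KP _ k1K; have [p2 P2] := KP _ (regsetV c00 c01 rK K1 k2K k20).
have [p3 P3] : exists p, s^-1 * slope i m = horner_mx t p by apply: KP; rewrite inE mulVKr.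
have E : be * (horner_mx t p1 * horner_mx t p2 * s^-1) = a m - a i.
  rewrite -P1 -P2 -alsE invrM ?unitrV // invrK !mulrA mulrK // mulrK //.
  by rewrite -[RHS](mulrK ucd) key.
exists (horner_mx t p1 * horner_mx t p2), (horner_mx t p1 * horner_mx t p2 * horner_mx t p3).
split=> //.
- by exists (p1 * p2); rewrite rmorphM.
- by exists (p1 * p2 * p3); rewrite !rmorphM.
- by rewrite -P3 -(slope_mul fi fm mi) -E !mulrA.
Qed.

Variable A : {set 'I_k}.
Hypothesis cA : (#|~: A| <= #|F| - 1)%N.
Hypotheses (rCa : regset Ca) (rCb : regset Cb).
Hypothesis rS : forall i, i \in A -> finite_index i -> regset (slope_set i).

(** The map sending the first coordinate of a point to its second one; the default [i0] is returned
    only outside [Ca]. *)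
Definition coord_map x := b (odflt i0 [pick m | finite_index m && (a m == x)]).
Local Notation f := coord_map.

Lemma coord_mapE m : finite_index m -> f (a m) = b m.
Proof.
move=> fm; rewrite /f; case: pickP => [m' /andP[fm' /eqP]|/(_ m)]; last by rewrite fm eqxx.
by move/a_inj => -> //.
Qed.

Lemma coord_map_lines i j x : i \in A -> j \in A -> finite_index i -> finite_index j ->
  i != j -> ~ slope_set i =i slope_set j -> x \in Ca ->
  on_line (a i) (a j) x -> on_line (f (a i)) (f (a j)) (f x).
Proof.
move=> iA jA fi fj ij Sij /CaP[m fm ->] [c mE].
rewrite !coord_mapE //.
have [->|mi] := eqVneq m i; first exact: on_linel.
have [->|mj] := eqVneq m j; first exact: on_liner.
have ji : j != i by rewrite eq_sym.
have [c0 c00 c01] := exists_not01 q2.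
have [m1 m2] := andP fm; have [j1 j2] := andP fj; have [i1 i2] := andP fi.
have c_neq0 : c != 0.
  by apply: contraNneq mi => cz; apply/eqP/a_inj => //; rewrite mE cz scale0r addr0.
have rSj := rS jA fj; have rSi := rS iA fi.
have sijj : slope i j \in slope_set j by rewrite slope_sym // slope_in.
(* For [a m] on the line with parameter [c], [slope_eq] writes [c *: slope i m] as a combination of
   two slopes at [j]. So [slope i m] and [slope i j] are common slopes; as the sets differ, they are
   proportional. *)
have simj : slope i m \in slope_set j.
  have := slope_eq fi fj fm mi mj ij; rewrite mE [a i + _]addrC addrK -scalerAl scalerAr.
  move/(mulrI (a_unit fj fi ji)); rewrite scalerBr => /(canRL (subrK _)) E.
  have -> : slope i m = c^-1 *: (c *: slope i m) by rewrite scalerA mulVf // scale1r.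
  rewrite E; apply: (regsetZ rSj); apply: (regsetD c00 c01 rSj).
    by apply: (regsetB c00 c01 rSj) => //; apply: slope_in.
  by apply: (regsetZ rSj); apply: slope_in.
have us : slope i j \is a GRing.unit by apply: slope_unit.
have s0 : slope i j != 0 by apply: contraTneq us => ->; rewrite unitr0.
have [sc|nsc] := boolP (is_scalar_mx ((slope i j)^-1 * slope i m)); last first.
  case: Sij; apply: (regset_eq pn q2 rSi rSj _ sijj _ simj s0 nsc); exact: slope_in.
case/is_scalar_mxP: sc => d dE; exists (c * d).
have -> : b m = b i + (a m - a i) * slope i m by rewrite slope_mul // addrC subrK.
rewrite -[slope i m](mulVKr us) dE -[slope i j * _]/(slope i j *m _) mul_mx_scalar.
rewrite -scalerAr -(slope_mul fi fj ji) mE [a i + _]addrC addrK -scalerAl scalerA.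
by rewrite mulrC.
Qed.

Lemma exists_equal_slopes :
  (exists i j, [/\ i \in A, j \in A, finite_index i, finite_index j & i != j]) ->
  exists i j, [/\ i \in A, j \in A, finite_index i, finite_index j
               & i != j /\ slope_set i =i slope_set j].
Proof.
move=> [i [j [iA jA fi fj ij]]].
have [/existsP[i' /existsP[j' /andP[/and5P[]]]]|none] := boolP [exists i, exists j,
    [&& i \in A, j \in A, finite_index i, finite_index j & i != j]
    && [forall x, (x \in slope_set i) == (x \in slope_set j)]].
  by move=> ? ? ? ? ? /forallP S; exists i', j'; split=> //; split=> // x; exact: (eqP (S x)).
exists i, j; split=> //; split=> //.
have bad i' j' : i' \in A -> j' \in A -> finite_index i' -> finite_index j' -> i' != j' ->
    ~ slope_set i' =i slope_set j'.
  move=> iA' jA' fi' fj' ij' S; case/negP: none; apply/existsP; exists i'; apply/existsP; exists j'.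
  by rewrite iA' jA' fi' fj' ij'; apply/forallP => x; rewrite S.
have [c0 c00 c01] := exists_not01 q2.
pose G : {pred 'M[F]_n.+1} := [pred x | [exists m, [&& m \in A, finite_index m & x == a m]]].
have GP x : reflect (exists m, [/\ m \in A, finite_index m & x = a m]) (x \in G).
  apply: (iffP existsP) => -[m]; first by case/and3P=> ? ? /eqP ?; exists m.
  by case=> mA fm ->; exists m; rewrite mA fm eqxx.
have CD : forall x y, x \in Ca -> y \in Ca -> x + y \in Ca.
  by move=> ? ?; apply: (regsetD c00 c01 rCa).
have CZ : forall (c : F) x, x \in Ca -> c *: x \in Ca by move=> ? ?; apply: (regsetZ rCa).
have few_bad x y : x \in Ca -> y \in Ca -> x != y ->
    (exists z w, [/\ z != w, z \in G, w \in G, on_line x y z & on_line x y w]) \/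
    (forall z, z \in Ca -> ~ on_line x y z -> z \in G).
  move=> xC yC xy; pose g (c : F) := x + c *: (y - x).
  have ginj : injective g.
    move=> c d /addrI/eqP; rewrite -subr_eq0 -scalerBl scaler_eq0 !subr_eq0.
    by rewrite [y == x]eq_sym (negPf xy) orbF => /eqP.
  have gC c : g c \in Ca by apply: regset_line.
  have [/existsP[c /existsP[d /and3P[cd cG dG]]]|one] :=
      boolP [exists c, exists d, [&& c != d, g c \in G & g d \in G]].
    left; exists (g c), (g d); split=> //; [|by exists c | by exists d].
    by rewrite (inj_eq ginj).
  right=> z /CaP[m fm ->] nz; apply/GP; exists m; split=> //; apply: contraT => mA.
  pose h c := odflt i0 [pick m | finite_index m && (a m == g c)].
  (* By [gC] every [g c] is the coordinate of a point, so the default [i0] is never taken. *)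
  have hP c : finite_index (h c) /\ a (h c) = g c.
    rewrite /h; case: pickP => [m' /andP[fm' /eqP] //|no].
    by have /CaP[m' fm' E] := gC c; have := no m'; rewrite fm' E eqxx.
  have hinj : injective h.
    by move=> c d E; apply: ginj; have [_ <-] := hP c; have [_ <-] := hP d; rewrite E.
  pose Bc := [set c | g c \notin G].
  have cG : (#|~: Bc| <= 1)%N.
    rewrite leqNgt; apply: contra one => /card_gt1P[c [d [cB dB cd]]].
    move: cB dB; rewrite !in_setC !in_set !negbK => cB dB.
    by apply/existsP; exists c; apply/existsP; exists d; rewrite cd cB dB.
  (* At least q - 1 points of the line are outside [G], and at most q - 1 indices are outside [A]:
     the line uses up all of them. *)
  have hB : h @: Bc = ~: A.
    apply/eqP; rewrite eqEcard; apply/andP; split.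
      apply/subsetP => _ /imsetP[c cB ->]; rewrite in_set in cB; rewrite in_setC.
      apply: contra cB => hA; apply/GP; exists (h c); have [? <-] := hP c; by split.
    rewrite card_imset //; apply: leq_trans cA _; rewrite -(cardsC Bc).
    by rewrite leq_subLR addnC leq_add2r.
  have : m \in h @: Bc by rewrite hB inE.
  case/imsetP=> c _ mE; case: nz; exists c; rewrite mE.
  by have [_ ->] := hP c.
have add x y : x \in Ca -> y \in Ca -> f (x + y) = f x + f y.
  apply: (@line_preserving_additive F _ _ Ca G f q2 (regset0 rCa) CD CZ).
  - move=> _ _ /CaP[m fm ->] /CaP[m' fm' ->]; rewrite !coord_mapE // => /b_inj -> //.
  - move=> _ _ z /CaP[m fm ->] /CaP[m' fm' ->]; rewrite !coord_mapE // => -[c ->].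
    have /CbP[m2 fm2 ->] : b m + c *: (b m' - b m) \in Cb.
      by apply: regset_line => //; apply/CbP; [exists m | exists m'].
    by exists (a m2); rewrite ?coord_mapE //; apply/CaP; exists m2.
  - move=> _ _ z /GP[m [mA fm ->]] /GP[m' [mA' fm' ->]] mm' zl.
    have mneq : m != m' by apply: contra_neq mm' => ->.
    apply: (coord_map_lines mA mA' fm fm' mneq (bad _ _ mA mA' fm fm' mneq)) => //.
    case: zl => c ->; apply: regset_line => //; apply/CaP; [by exists m | by exists m'].
  - exact: few_bad.
  - by move=> u _; apply: not_all_multiples card_Ca.
  - by rewrite -{1}a_base coord_mapE ?b_base ?finite_i0.
have sub u v : finite_index u -> finite_index v -> slope_set u =i slope_set v.
  suff H u' v' : finite_index u' -> finite_index v' -> {subset slope_set u' <= slope_set v'}.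
    by move=> fu fv x; apply/idP/idP; apply: H.
  move=> fu fv x /slopesP[m [mu m2 ->]]; have [->|m1] := eqVneq m e1.
    have := slope_in fv; move/(_ e1); rewrite {1}/slope /slope eqxx; apply.
      by case/andP: fv; rewrite eq_sym.
    exact: e12.
  have fm : finite_index m by rewrite /finite_index m1.
  have aC r : finite_index r -> a r \in Ca by move=> fr; apply/CaP; exists r.
  (* The translation of first coordinates moving [u'] to [v'] takes [m] to [r]. As [f] is additive,
     second coordinates are translated too, and the slope is kept. *)
  have dC : a m - a u' \in Ca by rewrite (regsetB c00 c01 rCa) ?aC.
  have /CaP[r fr rE] := CD _ _ dC (aC _ fv).
  have ud := a_unit fm fu mu.
  have rv : r != v'.
    apply: contraTneq ud => rv; move/eqP: rE; rewrite rv -subr_eq0 addrK => /eqP ->.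
    by rewrite -[_ \in _]/(0 \is a GRing.unit) unitr0.
  have -> : slope u' m = slope v' r.
    rewrite /slope (negPf m1); case/andP: (fr) => /negPf -> _.
    rewrite -rE addrK -!coord_mapE // -rE add ?aC // addrK.
    have -> : f (a m) = f (a m - a u' + a u') by rewrite subrK.
    by rewrite add ?aC // addrK.
  by apply: slope_in => //; case/andP: fr.
exact: sub.
Qed.

End Coordinates.

Lemma regular_field_coords (F : finFieldType) n
    (pi : 'I_(#|F| ^ n.+1 + 2) -> {vspace 'rV[F]_(3 * n.+1)})
    (W : 'I_(#|F| ^ n.+1 + 2) -> {vspace 'rV[F]_(3 * n.+1)})
    (A : {set 'I_(#|F| ^ n.+1 + 2)}) :
  prime n.+1 -> (3 < #|F|)%N -> is_generalized_arc pi ->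
  (forall i, \dim (W i) = (2 * n.+1)%N /\ (W i :&: pi i = 0)%VS) ->
  (#|~: A| <= #|F| - 1)%N ->
  (forall i, i \in A -> is_regular_spread n.+1 (W i) (Delta pi i (W i))) ->
  field_coords pi.
Proof.
move=> pn q3 arc hW cA reg; have q2 := ltnW q3.
have k2 : (2 < #|F| ^ n.+1 + 2)%N by rewrite addn2 !ltnS expn_gt0 (ltnW (ltnW q2)).
(* At least q^(n+1) + 2 - (q - 1) indices are in [A], which exceeds 3 since q^(n+1) > q; two serve
   as points at infinity and two as affine points. *)
have : (3 < size (enum A))%N.
  rewrite -cardE; have := cardsC A; rewrite card_ord.
  have := lt_card_pow pn q2; lia.
have memA x : x \in enum A -> x \in A by rewrite mem_enum.
case: (enum A) (enum_uniq A) memA => [|e1 [|e2 [|i [|j s]]]] //= U memA _.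
have [e1A e2A iA jA] : [/\ e1 \in A, e2 \in A, i \in A & j \in A].
  by split; apply: memA; rewrite !inE eqxx ?orbT.
move: U; rewrite !inE !negb_or => /and4P[/and4P[n12 n1i n1j _] /and3P[n2i n2j _] /andP[ij _] _].
have [Q1 E1] := rowvs_dim (arc_dim arc e1); have [Q2 E2] := rowvs_dim (arc_dim arc e2).
have [P0 E0] := rowvs_dim (arc_dim arc i).
have u012 : uniq [:: e1; e2; i] by rewrite /= !inE negb_or n12 n1i n2i.
have fi : finite_index e1 e2 i by rewrite /finite_index eq_sym n1i eq_sym n2i.
have fj : finite_index e1 e2 j by rewrite /finite_index eq_sym n1j eq_sym n2j.
have /fin_all_exists[ab abE] m : exists ab : 'M[F]_n.+1 * 'M[F]_n.+1,
    finite_index e1 e2 m -> pi m = rowvs (P0 + ab.1 *m Q1 + ab.2 *m Q2).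
  have [fm|_] := boolP (finite_index e1 e2 m); last by exists (0, 0).
  by have [xy xyE] := affine_coord arc u012 E1 E2 E0 fm; exists xy.
pose a m := (ab m).1; pose b m := (ab m).2.
have rS r : r \in A -> finite_index e1 e2 r -> regset (slope_set e1 e2 a b r).
  move=> rA fr; have [dW Wpi] := hW r; case/andP: (fr) => r1 r2.
  apply: (slopes_regset k2 arc _ E1 E2 _ dW Wpi (reg _ rA)).
    by rewrite /= !inE negb_or r1 r2 n12.
  move=> m mr m2; exact: (slopeE arc u012 E1 E2 E0 abE fr mr m2).
have rCa : regset (Ca e1 e2 a).
  have [dW Wpi] := hW e2.
  apply: (slopes_regset k2 arc _ E0 E1 _ dW Wpi (reg _ e2A)).
    by rewrite /= !inE negb_or n2i eq_sym n12 eq_sym n1i.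
  by move=> m m2 m1; apply: (aE E2 abE).
have rCb : regset (Cb e1 e2 b).
  have [dW Wpi] := hW e1.
  apply: (slopes_regset k2 arc _ E0 E2 _ dW Wpi (reg _ e1A)).
    by rewrite /= !inE negb_or n1i n12 eq_sym n2i.
  by move=> m m1 m2; apply: (bE E1 abE).
have [|r [s' [rA sA fr fs [rs Srs]]]] :=
    exists_equal_slopes pn q2 arc u012 E1 E2 E0 abE cA rCa rCb rS.
  by exists i, j; split.
exact: (equal_slopes_coords pn q2 arc u012 E1 E2 E0 abE fr fs rs (rS _ rA fr) Srs).
Qed.

(** * Spans of Galois conjugates *)

Section ConjSpan.

Variables (F : finFieldType) (L : splittingFieldType F).
Local Notation G := ('Gal({:L} / 1%VS))%g.
Local Notation "A ^L" := (map_mx (in_alg L) A) (at level 8, format "A ^L").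
Local Notation conj s A := (map_mx (fun a : L => gal_repr s a) A).
Implicit Type s : gal_of {:L}.

Lemma card_Gal : #|G| = \dim {:L}.
Proof. by rewrite -(galois_dim (finField_galois (sub1v _))) dimv1 divn1. Qed.

Lemma conj_in_alg m N s (A : 'M[F]_(m, N)) : conj s A^L = A^L.
Proof. by apply/matrixP => i j; rewrite !mxE /= linearZ /= rmorph1. Qed.

Lemma conjM m N p s (A : 'M[L]_(m, N)) (B : 'M[L]_(N, p)) :
  conj s (A *m B) = conj s A *m conj s B.
Proof. exact: (map_mxM (gal_repr s)). Qed.

Lemma conj_sub m1 m2 N s (A : 'M[L]_(m1, N)) (B : 'M[L]_(m2, N)) :
  (conj s A <= conj s B)%MS = (A <= B)%MS.
Proof. exact: (map_submx (gal_repr s)). Qed.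

Lemma mxrank_conj m N s (A : 'M[L]_(m, N)) : \rank (conj s A) = \rank A.
Proof. exact: (mxrank_map (gal_repr s)). Qed.

Lemma conj_sub_span m N s (A : 'M[L]_(m, N)) : s \in G -> (conj s A <= conj_span A)%MS.
Proof. by move=> sG; apply: (sumsmx_sup s); rewrite ?genmxE. Qed.

Lemma sub_conj_span m N (A : 'M[L]_(m, N)) : (A <= conj_span A)%MS.
Proof.
apply: submx_trans (conj_sub_span A (group1 _)).
suff -> : conj (1%g : gal_of {:L}) A = A by [].
by apply/matrixP => i j; rewrite mxE gal_id.
Qed.

Lemma conj_spanS m1 m2 N (A : 'M[L]_(m1, N)) (B : 'M[L]_(m2, N)) :
  (A <= B)%MS -> (conj_span A <= conj_span B)%MS.
Proof.
move=> AB; apply/sumsmx_subP => s sG; rewrite genmxE.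
by apply: submx_trans (conj_sub_span _ sG); rewrite conj_sub.
Qed.

Lemma rank_conj_span m N (A : 'M[L]_(m, N)) : (\rank (conj_span A) <= \dim {:L} * \rank A)%N.
Proof.
rewrite -card_Gal -sum_nat_const.
apply: (@leq_trans (\sum_(s in G) \rank <<conj s A>>%MS)).
  rewrite /conj_span; elim/big_rec2: _ => [|s r B _ IH]; first by rewrite mxrank0.
  by apply: leq_trans (mxrank_adds_leqif _ _) _; rewrite leq_add2l.
by apply: leq_sum => s _; rewrite genmxE mxrank_conj.
Qed.

(** Galois conjugation fixes matrices over [F], so it commutes with multiplication by them. *)
Lemma conj_spanM m N p (A : 'M[L]_(m, N)) (B : 'M[F]_(N, p)) :
  (conj_span (A *m B^L) :=: conj_span A *m B^L)%MS.
Proof.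
apply: eqmx_trans (eqmx_sym (sumsmxMr_gen _ _ _)).
apply: eqmx_sums => s _; apply: eqmx_trans (genmxE _) _; apply: eqmx_sym.
apply: eqmx_trans (genmxE _) _.
by rewrite conjM conj_in_alg; apply: eqmxMr; apply: genmxE.
Qed.

Lemma in_alg_sub m1 m2 N (A : 'M[F]_(m1, N)) (B : 'M[F]_(m2, N)) :
  (A^L <= B^L)%MS = (A <= B)%MS.
Proof. exact: map_submx. Qed.

Lemma rowvs_full_in_alg m N (A : 'M[F]_(m, N)) : rowvs A = fullv -> row_full A^L.
Proof.
move=> full; rewrite -sub1mx -(map_mx1 (in_alg L)) in_alg_sub -rowvs_sub full.
exact: subvf.
Qed.

End ConjSpan.

Section Eigenvector.

Variables (F : finFieldType) (n : nat) (t : 'M[F]_n.+1) (L : splittingFieldType F) (z : L).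
Local Notation G := ('Gal({:L} / 1%VS))%g.
Local Notation "A ^L" := (map_mx (in_alg L) A) (at level 8, format "A ^L").
Local Notation conj s A := (map_mx (fun a : L => gal_repr s a) A).
Hypothesis dL : \dim {:L} = n.+1.
Hypothesis Lz : <<1; z>>%VS = fullv.
Variable eta : 'rV[L]_n.+1.
Hypotheses (eta0 : eta != 0) (etaE : eta *m t^L = z *: eta).

Lemma gal_generator_inj : {in G &, injective (fun s : gal_of {:L} => s z)}.
Proof.
move=> s r sG rG sr; apply/eqP/gal_eqP => a _.
have : a \in <<1; z>>%VS by rewrite Lz memvf.
case/Fadjoin_polyP=> p p1 ->.
have E (u : gal_of {:L}) : u \in G -> u p.[z] = p.[u z].
  move=> uG; rewrite -horner_map /=; congr (_.[_]); apply/polyP => i; rewrite coef_map /=.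
  by apply: (fixed_gal (sub1v _) uG); apply: (polyOverP p1).
by rewrite !E // sr.
Qed.

(** The conjugates are eigenvectors for the distinct eigenvalues [s z], hence independent, and there
    are [n.+1] of them. *)
Lemma conj_span_eigenvector : row_full (conj_span eta).
Proof.
have sub (s : gal_of {:L}) : (conj s eta <= eigenspace t^L (s z))%MS.
  apply/eigenspaceP; rewrite -(conj_in_alg s) -conjM etaE.
  by apply/rowP => i; rewrite !mxE rmorphM.
have dx : mxdirect (\sum_(s in G) <<conj s eta>>)%MS.
  apply/mxdirect_sumsP => s sG; apply/eqP; rewrite -submx0.
  have /mxdirect_sumsP/(_ s sG) E := mxdirect_sum_eigenspace t^L gal_generator_inj.
  rewrite -[X in (_ <= X)%MS]E.
  apply: capmxS; first by rewrite genmxE.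
  apply/sumsmx_subP => r rG.
  by rewrite genmxE (sumsmx_sup r).
have cG : n.+1 = (\sum_(s in G) 1)%N by rewrite sum1_card card_Gal dL.
rewrite /row_full /conj_span (mxdirectP dx) /= [X in _ == X]cG.
by apply/eqP/eq_bigr => s _; rewrite genmxE mxrank_conj rank_rV eta0.
Qed.

(** Multiplication by [eta] turns coordinates in [F[t]] into scalars of [L]. *)
Lemma eigenvector_horner p : eta *m (horner_mx t p)^L = (map_poly (in_alg L) p).[z] *: eta.
Proof.
elim/poly_ind: p => [|p c IH]; first by rewrite !rmorph0 horner0 scale0r mulmx0.
have -> : map_poly (in_alg L) (p * 'X + c%:P) = map_poly (in_alg L) p * 'X + (in_alg L c)%:P.
  by rewrite rmorphD rmorphM /= map_polyX map_polyC.
have -> : horner_mx t (p * 'X + c%:P) = horner_mx t p *m t + c%:M.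
  by rewrite rmorphD rmorphM /= horner_mx_X horner_mx_C.
rewrite !hornerE map_mxD map_mxM /= map_scalar_mx mulmxDr mulmxA IH mul_mx_scalar.
by rewrite -scalemxAl etaE scalerA -scalerDl.
Qed.

End Eigenvector.

Section CoordsRegular.

Variables (F : finFieldType) (n : nat).
Variable pi : 'I_(#|F| ^ n.+1 + 2) -> {vspace 'rV[F]_(3 * n.+1)}.
Hypothesis arc : is_generalized_arc pi.
Variables (t : 'M[F]_n.+1) (T1 T2 T3 : 'M[F]_(n.+1, 3 * n.+1)).
Hypothesis full : (rowvs T1 + rowvs T2 + rowvs T3 = fullv)%VS.
Hypothesis coords : forall m, exists p1 p2 p3, pi m =
  rowvs (horner_mx t p1 *m T1 + horner_mx t p2 *m T2 + horner_mx t p3 *m T3).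

Lemma standard_over (L : splittingFieldType F) (z : L) :
  \dim {:L} = n.+1 -> root (map_poly (in_alg L) (mxminpoly t)) z -> <<1; z>>%VS = fullv ->
  is_standard_regular pi.
Proof.
move=> dL rz Lz.
have : eigenvalue (map_mx (in_alg L) t) z by rewrite eigenvalue_root_min mxminpoly_map.
case/eigenvalueP=> eta etaE eta0.
have eta_full := conj_span_eigenvector dL Lz eta0 etaE.
have span_eta (M : 'M[F]_(n.+1, 3 * n.+1)) :
    (conj_span (eta *m map_mx (in_alg L) M) :=: map_mx (in_alg L) M)%MS.
  exact: eqmx_trans (conj_spanM _ _) (eqmxMfull _ eta_full).
have /fin_all_exists[p pE] m : exists p : {poly F} * {poly F} * {poly F}, pi m =
    rowvs (horner_mx t p.1.1 *m T1 + horner_mx t p.1.2 *m T2 + horner_mx t p.2 *m T3).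
  by have [p1 [p2 [p3 E]]] := coords m; exists (p1, p2, p3).
pose M m := horner_mx t (p m).1.1 *m T1 + horner_mx t (p m).1.2 *m T2 + horner_mx t (p m).2 *m T3.
pose x m := eta *m map_mx (in_alg L) (M m).
pose xi := col_mx (col_mx (eta *m map_mx (in_alg L) T1) (eta *m map_mx (in_alg L) T2))
  (eta *m map_mx (in_alg L) T3) : 'M[L]_(1 + 1 + 1, 3 * n.+1).
(* The [n.+1] conjugates of a space of rank r span at most (n + 1) r dimensions. *)
have rank3 m (A : 'M[L]_(m, 3 * n.+1)) : row_full (conj_span A) -> (3 <= \rank A)%N.
  move=> fA; have := rank_conj_span A; rewrite (eqP fA) dL.
  by rewrite [X in (_ <= X)%N]mulnC leq_pmul2r.
have : (xi <= xi)%MS by [].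
rewrite {1}/xi !col_mx_sub => /andP[/andP[s1 s2] s3].
have xi_full : row_full (conj_span xi).
  have : row_full (map_mx (in_alg L) (col_mx (col_mx T1 T2) T3)).
    by apply: rowvs_full_in_alg; rewrite !rowvs_col.
  rewrite -!sub1mx => /submx_trans; apply; rewrite !map_col_mx !col_mx_sub.
  by rewrite -(span_eta T1) -(span_eta T2) -(span_eta T3) !conj_spanS.
have x_xi m : (x m <= xi)%MS.
  rewrite /x /M !map_mxD !map_mxM /= !mulmxDr !mulmxA !(eigenvector_horner etaE) -!scalemxAl.
  by rewrite !addmx_sub ?scalemx_sub.
have rxi : \rank xi = 3%N by apply/eqP; rewrite eqn_leq rank_leq_row rank3.
exists L; split=> //; exists xi, x; split=> //.
- split=> [m|i j l ijl].
    split=> //; rewrite -mxrank_eq0 -lt0n.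
    have := rank_conj_span (x m); rewrite span_eta mxrank_map -dim_rowvs -pE dL.
    by rewrite (arc_dim arc) -{1}[n.+1]muln1 leq_pmul2l.
  apply/eqP; rewrite eqn_leq; apply/andP; split.
    apply: leq_trans (rank_leq_row xi).
    by apply: mxrankS; rewrite !addsmx_sub !x_xi.
  apply: rank3.
  have : row_full (map_mx (in_alg L) (col_mx (col_mx (M i) (M j)) (M l))).
    apply: rowvs_full_in_alg; rewrite !rowvs_col -!pE.
    by case: arc => _ _; apply.
  rewrite -!sub1mx => /submx_trans; apply; rewrite !map_col_mx !col_mx_sub.
  rewrite -(span_eta (M i)) -(span_eta (M j)) -(span_eta (M l)) !conj_spanS //.
  + exact: addsmxSr.
  + exact: submx_trans (addsmxSr _ _) (addsmxSl _ _).
  + exact: submx_trans (addsmxSl _ _) (addsmxSl _ _).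
- by move=> m v; rewrite span_eta in_alg_sub pE mem_rowvs.
Qed.

End CoordsRegular.

Lemma field_coords_regular (F : finFieldType) n
    (pi : 'I_(#|F| ^ n.+1 + 2) -> {vspace 'rV[F]_(3 * n.+1)}) :
  is_generalized_arc pi -> field_coords pi -> is_regular_pseudo_hyperoval pi.
Proof.
move=> arc [t [T1 [T2 [T3 [irr deg full coords]]]]].
exists pi, \1%VF; split; last by move=> i; rewrite lim1g.
  (* Adjoining a root of the irreducible minimal polynomial of [t] gives the field with q^(n+1)
     elements. *)
  have [L0 dL [z rz Lz]] := irredp_FAdjoin irr; rewrite size_mxminpoly deg /= in dL.
  exact: (@standard_over _ _ _ arc t T1 T2 T3 full coords (FinSplittingFieldType F L0) z dL rz Lz).
by apply/eqP/lker0P => u v; rewrite !id_lfunE.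
Qed.

(** A projectivity over [F] commutes with Galois conjugation, so it can be absorbed into the plane
    [xi] and the points [x i]. *)
Lemma regular_standard (F : finFieldType) n (pi : 'I_(#|F| ^ n + 2) -> {vspace 'rV[F]_(3 * n)}) :
  is_regular_pseudo_hyperoval pi -> is_standard_regular pi.
Proof.
case=> rho [g [[L [dL [xi [x [rxi fxi [x1 x3] rhoE]]]]] g0 piE]].
pose H := lin1_mx g; pose HL := map_mx (in_alg L) H.
have uH : H \in unitmx.
  rewrite -row_free_unit; apply: inj_row_free => v; rewrite mul_rV_lin1 /= => gv.
  by apply/(lker0P (introT eqP g0)); rewrite gv linear0.
have uHL : HL \in unitmx by rewrite map_unitmx.
have fHL : row_free HL by rewrite row_free_unit.
exists L; split=> //; exists (xi *m HL), (fun i => x i *m HL); split.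
- by rewrite mxrankMfree.
- rewrite /row_full conj_spanM mxrankMfree //; exact: fxi.
- split=> [i|i j l ijl].
    have [xi0 xix] := x1 i; split; last exact: submxMr.
    by rewrite -mxrank_eq0 mxrankMfree // mxrank_eq0.
  rewrite -[RHS](x3 _ _ _ ijl) -[RHS](mxrankMfree _ fHL).
  have E : ((x i + x j + x l)%MS *m HL :=: x i *m HL + x j *m HL + x l *m HL)%MS.
    exact: eqmx_trans (addsmxMr _ _ _) (adds_eqmx (addsmxMr _ _ _) (eqmx_refl _)).
  by rewrite E.
move=> i v; rewrite piE conj_spanM.
have -> : (v \in (g @: rho i)%VS) = (v *m invmx H \in rho i).
  apply/memv_imgP/idP => [[w wr ->]|vr].
    by rewrite -(mul_rV_lin1 g) mulmxK.
  by exists (v *m invmx H) => //; rewrite -(mul_rV_lin1 g) mulmxKV.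
rewrite rhoE map_mxM map_invmx -/HL; apply/idP/idP => [/(submxMr HL)|/(submxMr (invmx HL))].
  by rewrite mulmxKV.
by rewrite mulmxK.
Qed.

(** * Spreads of a standard regular pseudo-hyperoval *)

Section StandardRegular.

Variables (F : finFieldType) (n : nat) (L : splittingFieldType F).
Local Notation k := (#|F| ^ n + 2)%N.
Local Notation G := ('Gal({:L} / 1%VS))%g.
Local Notation "A ^L" := (map_mx (in_alg L) A) (at level 8, format "A ^L").
Local Notation conj s A := (map_mx (fun a : L => gal_repr s a) A).
Hypotheses (n0 : (0 < n)%N) (dL : \dim {:L} = n).
Variables (xi : 'M[L]_(3, 3 * n)).
Hypotheses (rxi : \rank xi = 3%N) (fxi : row_full (conj_span xi)).

(** There are [n] conjugates of rank 3, and they span [3 * n] dimensions. *)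
Lemma mxdirect_conj : mxdirect (\sum_(s in G) <<conj s xi>>)%MS.
Proof.
apply/mxdirectP; rewrite /= -[X in \rank X]/(conj_span xi) (eqP fxi).
rewrite (eq_bigr (fun=> 3%N)) => [|s _]; last by rewrite genmxE mxrank_conj.
by rewrite sum_nat_const card_Gal dL mulnC.
Qed.

Lemma rank_conj_span_sub m (A : 'M[L]_(m, 3 * n)) : (A <= xi)%MS ->
  \rank (conj_span A) = (n * \rank A)%N.
Proof.
move=> Axi.
have dx : mxdirect (\sum_(s in G) <<conj s A>>)%MS.
  apply/mxdirect_sumsP => s sG; apply/eqP; rewrite -submx0.
  have /mxdirect_sumsP/(_ s sG) E := mxdirect_conj; rewrite -[X in (_ <= X)%MS]E.
  apply: capmxS; first by rewrite !genmxE conj_sub.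
  apply/sumsmx_subP => r rG; apply: (sumsmx_sup r) => //.
  by rewrite !genmxE conj_sub.
rewrite /conj_span (mxdirectP dx) /= (eq_bigr (fun=> \rank A)) => [|s _].
  by rewrite sum_nat_const card_Gal dL.
by rewrite genmxE mxrank_conj.
Qed.

(** The components of [u] along the conjugates of [xi] are unique, so each lies in the conjugates of
    both [A] and [B]. *)
Lemma conj_span_cap m1 m2 (A : 'M[L]_(m1, 3 * n)) (B : 'M[L]_(m2, 3 * n)) (u : 'rV[L]_(3 * n)) :
  (A <= xi)%MS -> (B <= xi)%MS -> (u <= conj_span A)%MS -> (u <= conj_span B)%MS ->
  (u <= conj_span (A :&: B)%MS)%MS.
Proof.
move=> Axi Bxi uA uB.
have uxi : (u <= \sum_(s in G) <<conj s xi>>)%MS := submx_trans uA (conj_spanS Axi).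
have [u_ _ uE uniq_u] := sub_dsumsmx mxdirect_conj uxi.
have comp m (C : 'M[L]_(m, 3 * n)) : (C <= xi)%MS -> (u <= conj_span C)%MS ->
    forall s, s \in G -> (u_ s <= conj s C)%MS.
  move=> Cxi /sub_sumsmxP[w wE] s sG.
  have <- := uniq_u (fun s => w s *m <<conj s C>>%MS) _ wE s sG.
    by apply: submx_trans (submxMl _ _) _; rewrite genmxE.
  move=> r rG; apply: submx_trans (submxMl _ _) _; by rewrite !genmxE conj_sub.
rewrite uE; apply: summx_sub => s sG.
apply: submx_trans (conj_sub_span _ sG).
have capE : (conj s (A :&: B)%MS :=: conj s A :&: conj s B)%MS by exact: (map_capmx (gal_repr s)).
by rewrite capE sub_capmx !comp.
Qed.

Lemma conj_span_rational m1 m2 (A : 'M[L]_(m1, 3 * n)) (X : 'M[F]_(m2, 3 * n)) :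
  (A <= X^L)%MS -> (conj_span A <= X^L)%MS.
Proof.
move=> AX; apply/sumsmx_subP => s sG.
by rewrite genmxE -(conj_in_alg s X) conj_sub.
Qed.

Variable pi : 'I_k -> {vspace 'rV[F]_(3 * n)}.
Hypothesis arc : is_generalized_arc pi.
Variable x : 'I_k -> 'rV[L]_(3 * n).
Hypothesis xhyp : is_hyperoval xi x.
Hypothesis piE : forall i v, (v \in pi i) = (v^L <= conj_span (x i))%MS.

Lemma x_xi i : (x i <= xi)%MS. Proof. by case: xhyp => /(_ i)[]. Qed.
Lemma rank_x i : \rank (x i) = 1%N.
Proof. by rewrite rank_rV; case: xhyp => /(_ i)[->]. Qed.

(** [piE] gives one inclusion, and both sides have rank [n]. *)
Lemma pi_span i (M : 'M[F]_(n, 3 * n)) : pi i = rowvs M -> (M^L :=: conj_span (x i))%MS.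
Proof.
move=> E; apply/eqmxP; rewrite -mxrank_leqif_eq.
  rewrite mxrank_map -dim_rowvs -E (arc_dim arc) rank_conj_span_sub ?x_xi // rank_x muln1.
  by [].
by apply/row_subP => r; rewrite -map_row -piE E mem_rowvs row_sub.
Qed.

Lemma rV_adds3P (v a b c : 'rV[L]_(3 * n)) : (v <= a + b + c)%MS ->
  exists ca cb cc, v = ca *: a + cb *: b + cc *: c.
Proof.
case/sub_addsmxP=> -[u w] /= ->.
have /sub_addsmxP[[u1 u2] /= ->] : (u *m (a + b)%MS <= a + b)%MS by apply: submxMl.
have sc (y : 'M[L]_1) (e : 'rV[L]_(3 * n)) : y *m e = y 0 0 *: e.
  by rewrite {1}[y]mx11_scalar mul_scalar_mx.
by exists (u1 0 0), (u2 0 0), (w 0 0); rewrite !sc.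
Qed.

Lemma x_free i j l : uniq [:: i; j; l] -> ~~ (x l <= x i + x j)%MS.
Proof.
case: xhyp => _ H /H r3; apply/negP => xl.
have : (\rank (x i + x j + x l)%MS <= \rank (x i + x j)%MS)%N.
  by apply: mxrankS; rewrite addsmx_sub submx_refl.
rewrite r3 => /leq_trans/(_ (mxrank_adds_leqif _ _)).
by rewrite !rank_x.
Qed.

Lemma xi_adds i j l : uniq [:: i; j; l] -> (xi <= x i + x j + x l)%MS.
Proof.
case: xhyp => _ H /H r3.
have le : (x i + x j + x l <= xi)%MS by rewrite !addsmx_sub !x_xi.
by rewrite -(geq_leqif (mxrank_leqif_sup le)) rxi r3.
Qed.

Lemma x_coords i j (P A : 'M[F]_(n, 3 * n)) : pi i = rowvs P -> (pi j <= rowvs P + rowvs A)%VS ->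
  exists p a : 'rV[L]_n, x j = p *m P^L + a *m A^L.
Proof.
move=> iP jPA; have [M ME] := rowvs_dim (arc_dim arc j).
have : (x j <= (col_mx P A)^L)%MS.
  apply: submx_trans (sub_conj_span _) _; rewrite -(pi_span ME) in_alg_sub.
  by rewrite -rowvs_sub rowvs_col -ME.
case/submxP=> u ->; exists (lsubmx u), (rsubmx u).
by rewrite map_col_mx -{1}[u]hsubmxK mul_row_col.
Qed.

(* The members of the regulus of three elements of [Delta] meet the plane [xi]
   in a line through [x i]. *)
Lemma pencil_plane i j l t (P A B : 'M[F]_(n, 3 * n)) (c d : F) :
  uniq [:: i; j; l; t] -> pi i = rowvs P ->
  (pi j <= rowvs P + rowvs A)%VS -> (pi l <= rowvs P + rowvs B)%VS ->
  (pi t <= rowvs P + rowvs (A + B))%VS -> (rowvs P + rowvs A + rowvs B = fullv)%VS ->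
  (c != 0) || (d != 0) ->
  exists y : 'rV[L]_(3 * n), [/\ (y <= xi)%MS, \rank (x i + y)%MS = 2%N
    & (y <= (col_mx P (c *: A + d *: B))^L)%MS].
Proof.
move=> U iP jA lB tAB full cd.
move: U; rewrite /= !inE !negb_or => /and4P[/and3P[ij il it] /andP[jl jt] lt _].
have u_ijl : uniq [:: i; j; l] by rewrite /= !inE negb_or ij il jl.
have u_ijt : uniq [:: i; j; t] by rewrite /= !inE negb_or ij it jt.
have u_ilt : uniq [:: i; l; t] by rewrite /= !inE negb_or il it lt.
have u_ilj : uniq [:: i; l; j] by rewrite /= !inE negb_or ij il eq_sym jl.
have [pj [aj xj]] := x_coords iP jA; have [pl [al xl]] := x_coords iP lB.
have [pt [at_ xt]] := x_coords iP tAB.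
have [p0 xi0] : exists p0 : 'rV[L]_n, x i = p0 *m P^L.
  have : (x i <= P^L)%MS by rewrite (pi_span iP) sub_conj_span.
  by case/submxP=> p0 ->; exists p0.
(* As no three points are collinear, [x t] has nonzero coefficients at [x j] and [x l]. *)
have [ci [cj [cl E]]] := rV_adds3P (submx_trans (x_xi t) (xi_adds u_ijl)).
have cj0 : cj != 0.
  apply/negP => /eqP cj0; case/negP: (x_free u_ilt); rewrite E cj0 scale0r addr0.
  by rewrite addmx_sub_adds // scalemx_sub.
have cl0 : cl != 0.
  apply/negP => /eqP cl0; case/negP: (x_free u_ijt); rewrite E cl0 scale0r addr0.
  by rewrite addmx_sub_adds // scalemx_sub.
have fr : row_free (col_mx (col_mx P A) B)^L.
  rewrite /row_free mxrank_map -dim_rowvs !rowvs_col full dimvf /dim /= mul1n.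
  by rewrite !mulSn mul0n addn0 addnA.
have [tj tl] : at_ = cj *: aj /\ at_ = cl *: al.
  have : row_mx (row_mx pt at_) at_ =
      row_mx (row_mx (ci *: p0 + cj *: pj + cl *: pl) (cj *: aj)) (cl *: al).
    apply: (row_free_inj fr); rewrite !map_col_mx !mul_row_col.
    rewrite -addrA -mulmxDr -map_mxD -xt E xi0 xj xl !mulmxDl -!scalemxAl !scalerDr.
    rewrite -!addrA; congr (_ + (_ + _)).
    by rewrite addrCA.
  by case/eq_row_mx => /eq_row_mx[_ <-] <-.
(* With these weights the [A]- and [B]-parts of [y] are [c] and [d] times the same vector [at_]. *)
pose y := (c%:A * cj) *: x j + (d%:A * cl) *: x l.
have yE : y = ((c%:A * cj) *: pj + (d%:A * cl) *: pl) *m P^L + at_ *m (c *: A + d *: B)^L.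
  rewrite /y xj xl mulmxDl map_mxD mulmxDr !map_mxZ /= -!scalemxAr {1}tj tl.
  rewrite -!scalemxAl !scalerDr !scalerA; by rewrite addrACA.
exists y; split.
- by rewrite addmx_sub ?scalemx_sub ?x_xi.
- apply/eqP; rewrite eqn_leq; apply/andP; split.
    apply: leq_trans (mxrank_adds_leqif _ _) _; rewrite rank_x rank_rV.
    by case: (y != 0).
  rewrite ltnNge; apply/negP => r1.
  have : (y <= x i)%MS.
    apply: submx_trans (addsmxSr (x i) y) _.
    by rewrite -(geq_leqif (mxrank_leqif_sup (addsmxSl (x i) y))) rank_x.
  move=> yi.
  have key (e e' : L) j' l' : uniq [:: i; l'; j'] -> e != 0 ->
      ((e *: x j' + e' *: x l')%R <= x i)%MS -> False.
    move=> u e0 H; case/negP: (x_free u).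
    have -> : x j' = e^-1 *: ((e *: x j' + e' *: x l') - e' *: x l').
      by rewrite addrK scalerA mulVf // scale1r.
    apply: scalemx_sub; apply: addmx_sub; first exact: submx_trans H (addsmxSl _ _).
    by rewrite -scaleNr scalemx_sub // addsmxSr.
  have alg0 (e : F) : e != 0 -> e%:A != 0 :> L by rewrite scaler_eq0 oner_eq0 orbF.
  case/orP: cd => [c0|d0].
    by apply: (key _ _ _ _ u_ilj _ yi); rewrite mulf_neq0 ?alg0.
  by apply: (key (d%:A * cl) (c%:A * cj) l j u_ijl); rewrite ?mulf_neq0 ?alg0 // addrC.
- by apply/submxP; exists (row_mx ((c%:A * cj) *: pj + (d%:A * cl) *: pl) at_);
    rewrite map_col_mx mul_row_col yE.
Qed.

(** The conjugates of the line [x i + y] span [pi i + rowvs N] over [L]. A nonzero vector [u] of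
    [rowvs N] lies in some [pi i + pi m], since [Delta] covers [W]. This forces the lines [x i + y]
    and [x i + x m] to coincide. *)
Lemma plane_Delta i W (P N : 'M[F]_(n, 3 * n)) (y : 'rV[L]_(3 * n)) :
  \dim W = (2 * n)%N -> (W :&: pi i = 0)%VS -> pi i = rowvs P ->
  (rowvs N <= W)%VS -> \dim (rowvs N) = n ->
  (y <= xi)%MS -> \rank (x i + y)%MS = 2%N -> (y <= (col_mx P N)^L)%MS ->
  rowvs N \in Delta pi i W.
Proof.
move=> dW Wpi iP NW dN yxi rxy yX.
have k2 : (2 < k)%N by rewrite addn2 !ltnS expn_gt0 -cardsT (cardsD1 0) inE.
have [_ cover] := Delta_spread n0 k2 arc dW Wpi erefl.
have capN : (pi i :&: rowvs N = 0)%VS.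
  by apply/eqP; rewrite -subv0 -Wpi capvC; apply: capvS.
have iX : (x i <= (col_mx P N)^L)%MS.
  apply: submx_trans (_ : (P^L <= _)%MS); first by rewrite (pi_span iP) sub_conj_span.
  by rewrite in_alg_sub -rowvs_sub rowvs_col addvSl.
have spanX : (conj_span (x i + y)%MS :=: (col_mx P N)^L)%MS.
  apply/eqmxP; rewrite -mxrank_leqif_eq; last first.
    by apply: conj_span_rational; rewrite addsmx_sub iX.
  rewrite mxrank_map -(dim_rowvs (col_mx P N)) rowvs_col -iP dimv_disjoint_sum // (arc_dim arc) dN.
  by rewrite rank_conj_span_sub ?addsmx_sub ?x_xi // rxy muln2 addnn.
have u0 : vpick (rowvs N) != 0 by rewrite vpick0 -dimv_eq0 dN -lt0n.
have uN := memv_pick (rowvs N); set u := vpick _ in u0 uN.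
have uW : u \in W by apply: (subvP NW).
have [_ [/andP[/DeltaP[m mi ->] um] _]] := cover _ uW u0.
apply/DeltaP; exists m => //.
have [M mM] := rowvs_dim (arc_dim arc m).
have spanM : (conj_span (x i + x m)%MS :=: (col_mx P M)^L)%MS.
  apply/eqmxP; apply/andP; split.
    apply: conj_span_rational; rewrite addsmx_sub map_col_mx -!addsmxE.
    apply/andP; split.
      by apply: submx_trans (addsmxSl _ _); rewrite (pi_span iP) sub_conj_span.
    by apply: submx_trans (addsmxSr _ _); rewrite (pi_span mM) sub_conj_span.
  rewrite map_col_mx col_mx_sub (pi_span iP) (pi_span mM).
  by rewrite !conj_spanS ?addsmxSl ?addsmxSr.
have xiy_xi : (x i + y <= xi)%MS by rewrite addsmx_sub x_xi.
have xim_xi : (x i + x m <= xi)%MS by rewrite addsmx_sub !x_xi.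
have ucap : (u^L <= conj_span ((x i + y) :&: (x i + x m))%MS)%MS.
  apply: conj_span_cap => //.
    by rewrite spanX in_alg_sub -mem_rowvs rowvs_col (subvP (addvSr _ _)).
  rewrite spanM in_alg_sub -mem_rowvs rowvs_col -iP -mM.
  by move: um; rewrite memv_cap => /andP[].
(* Lines meeting only in [x i] would put [u] into [pi i], but [u] is a nonzero vector of [W]. *)
have rcap : (2 <= \rank ((x i + y) :&: (x i + x m))%MS)%N.
  rewrite ltnNge; apply/negP => r1.
  have xcap : (x i <= (x i + y) :&: (x i + x m))%MS by rewrite sub_capmx !addsmxSl.
  have capx : ((x i + y) :&: (x i + x m) <= x i)%MS.
    by rewrite -(geq_leqif (mxrank_leqif_sup xcap)) rank_x.
  have : u \in pi i by rewrite piE (submx_trans ucap) // conj_spanS.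
  by move=> ui; case/negP: u0; rewrite -memv0 -Wpi memv_cap uW.
have eqy : (x i + y <= (x i + y) :&: (x i + x m))%MS.
  by rewrite -(geq_leqif (mxrank_leqif_sup (capmxSl _ _))) rxy.
have eqm : (x i + x m <= (x i + y) :&: (x i + x m))%MS.
  rewrite -(geq_leqif (mxrank_leqif_sup (capmxSr _ _))).
  apply: leq_trans (mxrank_adds_leqif _ _) _; by rewrite !rank_x.
have XM : rowvs (col_mx P N) = rowvs (col_mx P M).
  apply: eqmx_rowvs; apply/eqmxP/andP; split; rewrite -(in_alg_sub L).
    rewrite -spanX -spanM conj_spanS //.
    by apply: submx_trans eqy _; apply: capmxSr.
  rewrite -spanX -spanM conj_spanS //.
  by apply: submx_trans eqm _; apply: capmxSl.
rewrite mM iP -rowvs_col -XM rowvs_col -iP proj_along_cap //.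
apply: eqmx_rowvs; suff -> : N *m proj_along pi i W = N by [].
apply: mulmx_row_inj => v; rewrite mulmxA proj_along_id //.
by apply: (subvP NW); apply: rowvs_mul.
Qed.

Lemma standard_Delta_regular i W : \dim W = (2 * n)%N -> (W :&: pi i = 0)%VS ->
  is_regular_spread n W (Delta pi i W).
Proof.
move=> dW Wpi.
have k2 : (2 < k)%N by rewrite addn2 !ltnS expn_gt0 -cardsT (cardsD1 0) inE.
split=> [|U1 U2 U3 u123 S123 R regR R123 U UR]; first exact: Delta_spread.
have [j ji E1] : exists2 j, j != i & U1 = ((pi i + pi j) :&: W)%VS.
  by apply/DeltaP/S123; rewrite inE eqxx.
have [l li E2] : exists2 j, j != i & U2 = ((pi i + pi j) :&: W)%VS.
  by apply/DeltaP/S123; rewrite !inE eqxx orbT.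
have [t ti E3] : exists2 j, j != i & U3 = ((pi i + pi j) :&: W)%VS.
  by apply/DeltaP/S123; rewrite !inE eqxx !orbT.
have [jl jt lt] : [/\ j != l, j != t & l != t].
  move: u123; rewrite /= !inE negb_or !andbT => /andP[/andP[n12 n13] n23].
  by split; [apply: contra_neq n12|apply: contra_neq n13|apply: contra_neq n23];
    rewrite ?E1 ?E2 ?E3 => ->.
have [P iP] := rowvs_dim (arc_dim arc i); have [Mj jM] := rowvs_dim (arc_dim arc j).
have [Ml lM] := rowvs_dim (arc_dim arc l); have [Mt tM] := rowvs_dim (arc_dim arc t).
pose D := proj_along pi i W.
have fj := Delta_free k2 arc dW Wpi ji jM; have fl := Delta_free k2 arc dW Wpi li lM.
have ft := Delta_free k2 arc dW Wpi ti tM.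
have capE m (M : 'M[F]_(n, 3 * n)) : pi m = rowvs M -> ((pi i + pi m) :&: W)%VS = rowvs (M *m D).
  by move=> ->; rewrite proj_along_cap.
have cap0 a b : a != i -> b != i -> a != b ->
    (((pi i + pi a) :&: W) :&: ((pi i + pi b) :&: W) = 0)%VS by apply: Delta_cap.
have indjl : indep2 (Mj *m D) (Ml *m D).
  by apply: indep2_cap => //; rewrite -(capE _ _ jM) -(capE _ _ lM) cap0.
have indtj : indep2 (Mt *m D) (Mj *m D).
  by apply: indep2_cap => //; rewrite -(capE _ _ jM) -(capE _ _ tM) cap0 // eq_sym.
have indtl : indep2 (Mt *m D) (Ml *m D).
  by apply: indep2_cap => //; rewrite -(capE _ _ lM) -(capE _ _ tM) cap0 // eq_sym.
have WE : (rowvs (Mj *m D) + rowvs (Ml *m D) = W)%VS.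
  apply/eqP; rewrite eqEdim subv_add -(capE _ _ jM) -(capE _ _ lM) !capvSr /= dW.
  rewrite dimv_disjoint_sum ?cap0 // (capE _ _ jM) (capE _ _ lM) !dim_rowvs.
  by rewrite (eqP fj) (eqP fl) addnn mul2n.
have : (Mt *m D <= col_mx (Mj *m D) (Ml *m D))%MS.
  by rewrite -rowvs_sub rowvs_col WE -(capE _ _ tM) capvSr.
case/submxP=> Z; rewrite -[Z]hsubmxK mul_row_col; set X := lsubmx Z; set Y := rsubmx Z => tE.
have uX : X \in unitmx.
  rewrite -row_free_unit; apply: inj_row_free => v vX.
  have [] // := @indtl v (- (v *m Y)).
  by rewrite tE mulmxDr [v *m (X *m _)]mulmxA vX mul0mx add0r mulNmx [v *m (Y *m _)]mulmxA subrr.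
have uY : Y \in unitmx.
  rewrite -row_free_unit; apply: inj_row_free => v vY.
  have [] // := @indtj v (- (v *m X)).
  by rewrite tE mulmxDr [v *m (Y *m _)]mulmxA vY mul0mx addr0 mulNmx [v *m (X *m _)]mulmxA subrr.
(* Rescaled generators make the three given members [A], [B] and [A + B], so that the regulus lies
   in their pencil. *)
pose A := X *m (Mj *m D); pose B := Y *m (Ml *m D).
have RA : rowvs A = rowvs (Mj *m D) by apply: rowvs_unit.
have RB : rowvs B = rowvs (Ml *m D) by apply: rowvs_unit.
have RAB : rowvs (A + B) = rowvs (Mt *m D) by rewrite tE.
have indAB : indep2 A B.
  move=> v w; rewrite [v *m A]mulmxA [w *m B]mulmxA => /indjl[vX wY]; split.
    by rewrite -[v](mulmxK uX) vX mul0mx.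
  by rewrite -[w](mulmxK uY) wY mul0mx.
have WAB : (rowvs A + rowvs B = W)%VS by rewrite RA RB.
have UP : U \in pencil A B.
  apply: (regulus_pencil indAB regR WAB n0) UR; rewrite ?RA ?RB ?RAB.
  - by rewrite -(capE _ _ jM) -E1; apply: R123; rewrite inE eqxx.
  - by rewrite -(capE _ _ lM) -E2; apply: R123; rewrite !inE eqxx orbT.
  - by rewrite -(capE _ _ tM) -E3; apply: R123; rewrite !inE eqxx !orbT.
have dU := dim_pencil indAB UP.
case/pencil_hom: UP => c [d [cd UE]].
have sub m (M : 'M[F]_(n, 3 * n)) : pi m = rowvs M -> (pi m <= rowvs P + rowvs (M *m D))%VS.
  by move=> ->; rewrite -iP proj_along_add // addvSr.
have [|||||y [yxi rxy yX]] := @pencil_plane i j l t P A B c d _ iP _ _ _ _ cd.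
- by rewrite /= !inE !negb_or jl jt lt ![i == _]eq_sym ji li ti.
- by rewrite RA sub.
- by rewrite RB sub.
- by rewrite RAB sub.
- by rewrite -addvA WAB -iP addvC proj_along_full.
rewrite UE; apply: (plane_Delta dW Wpi iP _ _ yxi rxy yX); last by rewrite -UE.
rewrite -WAB; apply/subvP => _ /mem_rowvsP[v ->].
by rewrite mulmxDr -!scalemxAr memv_add // memvZ ?rowvs_mul.
Qed.

End StandardRegular.

(* Regularity of the pseudo-hyperoval in terms of its spreads *)
Local Close Scope ring_scope.

Theorem theorem7p1 (F : finFieldType) (h n delta0 : nat)
    (hF : #|F| = 2 ^ h) (hh : 1 < h) (hn : prime n)
    (hdelta0 : delta0 <= #|F| - 2)
    (hdesign : forall (P : finType) (B : {set {set P}}),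
        is_near_3design B (#|F| ^ n + 1) (#|F| + 1) delta0 ->
        is_3design B (#|F| ^ n + 1) (#|F| + 1))
    (pi : 'I_(#|F| ^ n + 2) -> {vspace 'rV[F]_(3 * n)})
    (hpi : is_pseudo_hyperoval pi)
    (W : 'I_(#|F| ^ n + 2) -> {vspace 'rV[F]_(3 * n)})
    (hW : forall i, \dim (W i) = 2 * n /\ (W i :&: pi i = 0)%VS) :
  is_regular_pseudo_hyperoval pi <->
  exists A : {set 'I_(#|F| ^ n + 2)},
    #|F| ^ n + 1 - delta0 <= #|A| /\
    (forall i, i \in A -> is_regular_spread n (W i) (Delta pi i (W i))).
Proof.
split=> [/regular_standard[L [dL [xi [x [rxi fxi xhyp piE]]]]]|[A [cA reg]]].
  exists setT; split=> [|i _]; first by rewrite cardsT card_ord; lia.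
  have [dW Wpi] := hW i.
  exact: (standard_Delta_regular (prime_gt0 hn) dL rxi fxi hpi xhyp piE dW Wpi).
have q3 : 3 < #|F| by rewrite hF -[4]/(2 ^ 2) leq_exp2l.
(* There are q^n + 2 indices, so at most [delta0 + 1], hence at most q - 1, are outside [A]. *)
have cCA : #|~: A| <= #|F| - 1 by have := cardsC A; rewrite card_ord; lia.
case: n hn {hdesign} pi hpi W hW A {cA} reg cCA => // n hn pi hpi W hW A reg cCA.
exact: field_coords_regular hpi (regular_field_coords hn q3 hpi hW cCA reg).
Qed.
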